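(* For every connected series-parallel graph $G$, there exists a vertex $v$ of $G$ such that all longest paths in $G$ contain $v$.
   Context: All graphs are finite and undirected. The length of a path is its number of edges. A path in $G$ is a longest path if no path in $G$ has strictly larger length. A 2-tree is defined recursively: a single edge ($K_2$) is a 2-tree; a graph $T$ that is not a single edge is a 2-tree if and only if it has a vertex $v$ of degree 2 whose two neighbors are adjacent and such that $T-v$ is also a 2-tree. A graph is series-parallel if it is a partial 2-tree, i.e. a subgraph of a 2-tree; equivalently, if it does not contain $K_4$ as a minor. *)

(* Defs.v *)
From HB Require Import structures.
From mathcomp Require Import all_boot.

Set Implicit Arguments.
Unset Strict Implicit.
Unset Printing Implicit Defensive.

Record sgraph := SGraph {
  vertex :> finType;
  adj : rel vertex;
  adj_sym : symmetric adj;
  adj_irrefl : irreflexive adj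
}.

Definition neighbors (G : sgraph) (v : G) : {set G} := [set x | adj v x].

Definition degree (G : sgraph) (v : G) : nat := #|neighbors v|.

Section DeleteVertex.
Variables (G : sgraph) (v : G).

Let V : finType := {x : G | x != v}.
Let del_adj : rel V := fun x y => adj (val x) (val y).

Fact del_adj_sym : symmetric del_adj.
Proof. by move=> x y; apply: adj_sym. Qed.

Fact del_adj_irrefl : irreflexive del_adj.
Proof. by move=> x; apply: adj_irrefl. Qed.

Definition del_vertex : sgraph := SGraph del_adj_sym del_adj_irrefl.
End DeleteVertex.

Definition single_edge (G : sgraph) : Prop :=
  #|G| = 2 /\ forall x y : G, x != y -> adj x y.

Inductive two_tree : sgraph -> Prop :=
| two_tree_edge (G : sgraph) : single_edge G -> two_tree G
| two_tree_step (G : sgraph) (v : G) :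
    degree v = 2 ->
    (forall x y : G, x \in neighbors v -> y \in neighbors v ->
       x != y -> adj x y) ->
    two_tree (del_vertex v) ->
    two_tree G.

(* Up to isomorphism: G embeds in H, as a not necessarily induced subgraph. *)
Definition subgraph (G H : sgraph) : Prop :=
  exists h : G -> H, injective h /\ forall x y : G, adj x y -> adj (h x) (h y).

Definition series_parallel (G : sgraph) : Prop :=
  exists H : sgraph, two_tree H /\ subgraph G H.

(* The graph without vertices is not connected. *)
Definition connected_graph (G : sgraph) : Prop :=
  0 < #|G| /\ forall x y : G, connect (@adj G) x y.

(* A path is given by its vertex sequence, without repetition; a single vertex
   is a path of length 0, the empty sequence is not a path. *)
Definition is_path (G : sgraph) (p : seq G) : bool :=
  [&& p != [::], uniq p & sorted (@adj G) p].

Definition path_length (G : sgraph) (p : seq G) : nat := (size p).-1.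

Definition longest_path (G : sgraph) (p : seq G) : Prop :=
  is_path p /\ forall q : seq G, is_path q -> path_length q <= path_length p.

(* Main.v *)
From Stdlib Require Import Classical.
Require Import Defs.
From mathcomp Require Import all_boot.
From mathcomp Require Import zify.

Set Implicit Arguments.
Unset Strict Implicit.
Unset Printing Implicit Defensive.

(** Suppose that every vertex is avoided by some longest path; call [L] the
    length of the longest paths. In a connected graph two longest paths always
    meet. The proof follows where they meet.

    Separations. For two vertices [x] and [y], a component [D] of the graph
    without [x] and [y] captures the longest paths if any longest path avoiding
    [y] meets any longest path avoiding [x] inside [D], and if every longest
    path meets [D]. Such a component always exists ([component_captures]). A
    path avoiding [y] has a half on one side of the separation, and that half
    is met by every longest path avoiding [x] ([longest_half]). Either all these
    heavy sides agree, or only two components are involved; if both of them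
    failed, exchanging tails at [x] and at [y] would produce a path longer
    than [L].

    Triangles. A 2-tree is built from an edge by parallel composition and by
    adding an apex [z] to two terminals [x] and [y] ([piece],
    [two_tree_piece]). One descends along this construction, keeping a
    component inside the current piece that captures the longest paths for its
    terminals ([piece_captures_not]). At an apex there are three separations,
    made of two of the vertices [x], [y], [z] each. If neither of the
    separations with [z] could be used to descend, all three separations would
    capture the longest paths towards the triangle. The heart of the proof is
    that this still allows one to descend ([triangle_captures]):

    - If a longest path [p] has only the vertex [x] on the triangle, it has one
      tail in each region at [x], and every longest path avoiding [x] crosses
      both tails. The component [D] of [p]'s tail between [x] and [z] then
      captures the longest paths for [x] and [z] ([single_captures]).
    - If every longest path has two vertices on the triangle, then those with
      exactly two meet pairwise opposite to their common vertex
      ([classes_meet]), and the component where the paths through [x], [y] meet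
      those through [y], [z] captures the longest paths for [x] and [z]
      ([no_single_captures]).

    In both cases a longest path that avoids [D] is excluded in the same way:
    two longest paths cross in [D], one coming from [x] and the other from [z],
    and a third one bypassing [D] would make one of several combinations too
    long ([no_bypass], [no_detour]). As pieces are finite, the descent is
    impossible. *)

(** * Walks and multiplicities *)

Section Multiplicities.

Variable T : finType.
Implicit Types (A B : seq T) (x y w : T).

Definition cnt A w : nat := count_mem w A.

Lemma cnt_cat A B w : cnt (A ++ B) w = cnt A w + cnt B w.
Proof. exact: count_cat. Qed.

Lemma cnt_cons x A w : cnt (x :: A) w = (x == w) + cnt A w.
Proof. by []. Qed.

Lemma cnt_nil w : cnt [::] w = 0.
Proof. by []. Qed.

Lemma mem_cnt A w : (w \in A) = (0 < cnt A w).
Proof. by rewrite /cnt -has_count has_pred1. Qed.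

Lemma cnt_uniq A : reflect (forall w, cnt A w <= 1) (uniq A).
Proof.
apply: (iffP idP) => [uA w | cA]; first by rewrite /cnt count_uniq_mem // leq_b1.
apply: count_mem_uniq => w; have := cA w; have := mem_cnt A w; rewrite /cnt.
by case: (count_mem w A) => [|[|]] // ->.
Qed.

Lemma cnt_notin A y : uniq A -> y \notin A -> forall w, cnt A w + (y == w) <= 1.
Proof.
move=> /cnt_uniq uA yA w; have := uA w.
by case: eqP => [<-|]; [move: yA; rewrite mem_cnt; lia | lia].
Qed.

Lemma notin_cnt A y : (forall w, cnt A w + (y == w) <= 1) -> y \notin A.
Proof. by move/(_ y); rewrite eqxx mem_cnt; lia. Qed.

Lemma cnt_disj A B : uniq A -> uniq B ->
  (forall w, cnt A w + cnt B w <= 1) \/ exists2 w, w \in A & w \in B.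
Proof.
move=> /cnt_uniq uA /cnt_uniq uB; case: (boolP (has (mem A) B)) => [/hasP[w wB wA]|no].
  by right; exists w.
left=> w; have := uA w; have := uB w.
have [wB|] := boolP (w \in B); last by rewrite mem_cnt; lia.
by move/hasPn: no => /(_ w wB) /=; rewrite mem_cnt; lia.
Qed.

Lemma cnt_sub A (D : {set T}) w : (forall v, cnt A v <= (v \in D)) -> w \in A -> w \in D.
Proof. by move=> /(_ w); rewrite mem_cnt; case: (w \in D) => //; case: (cnt A w). Qed.

Lemma neq_cnt x y : x != y -> forall w, (x == w) + (y == w) <= 1.
Proof.
move=> xy w; case: (eqVneq x w) xy => [<-|_ _]; last exact: leq_b1.
by rewrite eq_sym => /negPf->.
Qed.

Lemma avoid_notin x y u A : (forall w, cnt A w + (x == w) + (y == w) <= 1) ->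
  u \in A -> u \notin [:: x; y].
Proof. 
move=> /(_ u); rewrite mem_cnt !inE ![u == _]eq_sym.
by case: (x == u); case: (y == u) => //=; lia.
Qed.

Lemma cnt_ge1 A y : y \in A -> forall w, (y == w) <= cnt A w.
Proof. by move=> yA w; case: eqP => [<-|//]; rewrite mem_cnt in yA. Qed.

End Multiplicities.

Arguments cnt : simpl never.

(** Disjointness of pieces of paths is kept in the form of linear inequalities
    between multiplicities, so that a path made of many pieces is seen to be
    free of repetitions by linear arithmetic at each vertex. Boolean values
    are replaced by unknowns between 0 and 1, and other boolean hypotheses are
    dropped, because the case analysis of [lia] on booleans is exponential. *)
Ltac blia :=
  intros;
  repeat match goal with
  | H : is_true ?b |- _ => lazymatch b with
                     leq _ _ => fail | negb (leq _ _) => fail | _ => clear H end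
  end;
  change (nat_of_bool true) with 1 in *; change (nat_of_bool false) with 0 in *;
  repeat match goal with
  | H : context [nat_of_bool ?b] |- _ =>
      let n := fresh "n" in pose proof (leq_b1 b); set (n := nat_of_bool b) in *; clearbody n
  | |- context [nat_of_bool ?b] =>
      let n := fresh "n" in pose proof (leq_b1 b); set (n := nat_of_bool b) in *; clearbody n
  end;
  lia.

Ltac spec_at w :=
  repeat match goal with
  | H : forall v : _, is_true (leq (@?a v) (@?b v)) |- _ =>
      let K := fresh in pose proof (H w) as K; cbv beta in K;
      rewrite ?(cnt_cat, cnt_cons, cnt_nil) in K; clear H
  | H : forall v : _, @eq nat (@?a v) (@?b v) |- _ =>
      let K := fresh in pose proof (H w) as K; cbv beta in K;
      rewrite ?(cnt_cat, cnt_cons, cnt_nil) in K; clear H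
  end;
  rewrite ?(cnt_cat, cnt_cons, cnt_nil).

Ltac cnts := let w := fresh "w" in intro w; spec_at w; blia.

Section Walks.

Variables (T : finType) (e : rel T).
Hypothesis e_sym : symmetric e.
Implicit Types (x y z u v w s t : T) (A B p q : seq T) (D : {set T}).

(** The first vertex is left out of [A], so that walks are composed by
    concatenation. *)
Definition walk x A y : Prop := path e x A /\ last x A = y.

Lemma walk_cat x A y B z : walk x A y -> walk y B z -> walk x (A ++ B) z.
Proof. by move=> [pA lA] [pB lB]; split; rewrite ?cat_path ?last_cat ?pA lA. Qed.

Lemma walk_end x A y : walk x A y -> x != y -> forall w, (y == w) <= cnt A w.
Proof.
case: A => [|a A] [_ lA] xy; first by move: xy; rewrite -lA eqxx.
by apply: cnt_ge1; rewrite -lA; apply: (mem_last a A).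
Qed.

(** A reversed walk omits [y] instead of [x]; the balance of multiplicities
    records this exchange. *)
Lemma walk_rev x A y : walk x A y ->
  exists B, [/\ walk y B x, size B = size A & forall w, cnt B w + (y == w) = (x == w) + cnt A w].
Proof.
move=> [pA lA]; exists (rev (belast x A)); split.
- split; last by case: A {pA} lA => [<-|a A _] /=; rewrite ?rev_cons ?last_rcons.
  by rewrite -lA rev_path (eq_path (e' := e)) // => a b /=; rewrite e_sym.
- by rewrite size_rev size_belast.
- move=> w; rewrite /cnt count_rev -lA -[(x == w) + _]/(count_mem w (x :: A)) lastI.
  by rewrite -cats1 count_cat /= addn0.
Qed.

Lemma walk_split x A y u : walk x A y -> u \in x :: A ->
  exists A1 A2, [/\ A = A1 ++ A2, walk x A1 u, walk u A2 y &
    forall w, u \in A -> (u == w) <= cnt A1 w].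
Proof.
move=> [pA lA] uA; have [uA'|nuA] := boolP (u \in A).
  case/splitPr: uA' pA lA {uA} => A1 A2; rewrite cat_path last_cat /= => /and3P[p1 e1 p2] l2.
  exists (rcons A1 u), A2; split=> //; first by rewrite cat_rcons.
  - by split; rewrite ?rcons_path ?p1 ?last_rcons.
  - by move=> w _; apply: cnt_ge1; rewrite mem_rcons mem_head.
move: uA; rewrite inE (negPf nuA) orbF => /eqP->.
by exists [::], A; split.
Qed.

(** The first vertex of a walk in a given set; the inequality says that the
    part up to there meets that set nowhere else. *)
Lemma walk_first x A y B : walk x A y -> uniq A -> uniq B ->
  (exists2 u, u \in A & u \in B) ->
  exists u A1 A2, [/\ A = A1 ++ A2, walk x A1 u, walk u A2 y, u \in B &
    (forall w, (u == w) <= cnt A1 w) /\ (forall w, cnt A1 w + cnt B w <= 1 + (u == w))].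
Proof.
move=> [pA lA] uA /cnt_uniq uB [v vA vB]; have hB : has (mem B) A by apply/hasP; exists v.
case: (split_find hB) pA lA uA => u A1 A2 uinB /hasPn nB.
rewrite cat_path last_cat last_rcons => /andP[p1 p2] l2 uA.
exists u, (rcons A1 u), A2; split=> //; first by split; rewrite ?last_rcons.
split=> w; first by apply: cnt_ge1; rewrite mem_rcons mem_head.
move: uA; rewrite cat_uniq => /andP[/cnt_uniq/(_ w) + _].
case: (eqVneq u w) => [<-|uw]; first by have := uB u; lia.
have [wB|] := boolP (w \in B); last by rewrite mem_cnt; lia.
have : w \notin A1 by apply/negP => /nB /=; rewrite wB.
by rewrite -cats1 cnt_cat cnt_cons cnt_nil mem_cnt (negPf uw); have := uB w; lia.
Qed.

(** Symmetrically, the last vertex of a walk in a set that contains its start. *)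
Lemma walk_last x A y B : walk x A y -> uniq A -> uniq B -> x \in B ->
  exists u A1 A2, [/\ A = A1 ++ A2, walk x A1 u, walk u A2 y, u \in B &
    forall w, cnt A2 w + cnt B w <= 1].
Proof.
move=> wA + /cnt_uniq uB xB; elim/last_ind: A y wA => [|A a IH] y [pA lA] uA.
  by exists x, [::], [::]; split=> // w; rewrite cnt_nil.
move: pA lA uA; rewrite rcons_path last_rcons rcons_uniq => /andP[pA ea] <- /andP[naA uA].
have [aB|naB] := boolP (a \in B).
  exists a, (rcons A a), [::]; split=> //; first by rewrite cats0.
  by split; rewrite ?rcons_path ?pA ?last_rcons.
have [u [A1 [A2 [AE w1 [p2 l2] uB' dj]]]] := IH _ (conj pA erefl) uA.
exists u, A1, (rcons A2 a); split=> //; first by rewrite AE rcons_cat.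
  by split; rewrite ?rcons_path ?p2 ?l2 ?last_rcons.
move=> w; have := dj w; have := uB w; rewrite -cats1 cnt_cat cnt_cons cnt_nil.
case: (eqVneq a w) => [<-|]; last by lia.
move: naA naB; rewrite AE mem_cat !mem_cnt; lia.
Qed.

End Walks.

(** * Longest paths *)

(** [L] is a parameter; that no path is longer is stated apart, by [ce_bound]
    below, which allows the same paths to be considered in a larger graph. *)
Definition longest (T : finType) (e : rel T) (L : nat) (p : seq T) : Prop :=
  [/\ uniq p, sorted e p & size p = L.+1].

(** What a connected graph without a vertex common to all longest paths
    provides. Connectedness enters by [ce_meet] only, so isolated vertices may
    be added as long as [L] is positive. *)
Record counterexample (T : finType) (e : rel T) (L : nat) : Prop := {
  ce_sym : symmetric e;
  ce_bound : forall x A, path e x A -> uniq (x :: A) -> size A <= L;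
  ce_meet : forall p q, longest e L p -> longest e L q -> exists2 v, v \in p & v \in q;
  ce_avoid : forall v, exists2 p, longest e L p & v \notin p
}.

Section Decompositions.

Variables (T : finType) (e : rel T) (L : nat).
Hypothesis e_sym : symmetric e.
Implicit Types (x y z u v w s t : T) (A B p q : seq T).

Lemma longest_cnt p : longest e L p -> forall w, cnt p w <= 1.
Proof. by case=> /cnt_uniq. Qed.

Lemma longest_notin p v : longest e L p -> v \notin p -> forall w, cnt p w + (v == w) <= 1.
Proof. by case=> up _ _; apply: cnt_notin. Qed.

(** Both tails are read outwards from [x], so that either of them can be
    exchanged against another tail at [x]. *)
Lemma longest_at p x : longest e L p -> x \in p ->
  exists A s B t, [/\ walk e x A s, walk e x B t, size A + size B = L &
    forall w, cnt p w = (x == w) + cnt A w + cnt B w].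
Proof.
case: p => [[]//|a p] [up sp [szp]] xp.
have wp : walk e a p (last a p) by [].
have [A1 [A2 [E w1 w2 _]]] := walk_split wp xp.
have [A [wA sA cA]] := walk_rev e_sym w1.
exists A, a, A2, (last a p); split=> //; first by rewrite sA -szp E size_cat.
by move=> w; have := cA w; rewrite cnt_cons E cnt_cat; lia.
Qed.

Lemma longest_at2 p x y : longest e L p -> x \in p -> y \in p -> x != y ->
  exists A s M B t, [/\ walk e x A s, walk e x M y, walk e y B t,
    size A + size M + size B = L &
    (forall w, cnt p w = (x == w) + cnt A w + cnt M w + cnt B w) /\
    (forall w, (y == w) <= cnt M w)].
Proof.
move=> lp xp yp xy; have [A [s [B [t [wA wB sz cp]]]]] := longest_at lp xp.
have [yB|nyB] := boolP (y \in B).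
  have yB' : y \in x :: B by rewrite inE yB orbT.
  have [M [B2 [E wM wB2 cy]]] := walk_split wB yB'.
  exists A, s, M, B2, t; split=> //; first by rewrite -sz E size_cat addnA.
  by split=> w; [rewrite cp E cnt_cat; lia | apply: cy].
have yA : y \in A.
  by move: yp nyB; rewrite !mem_cnt cp (negPf xy); lia.
have yA' : y \in x :: A by rewrite inE yA orbT.
have [M [A2 [E wM wA2 cy]]] := walk_split wA yA'.
exists B, t, M, A2, s; split=> //; first by rewrite -sz E size_cat; lia.
by split=> w; [rewrite cp E cnt_cat; lia | apply: cy].
Qed.

Lemma longest_long_tail q u : longest e L q -> u \in q ->
  exists C c, [/\ walk e u C c, forall w, (u == w) + cnt C w <= cnt q w & L <= 2 * size C].
Proof.
move=> lq uq; have [C [c [D [d [wC wD sCD cq]]]]] := longest_at lq uq.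
have [h|h] := leqP (size D) (size C); [exists C, c | exists D, d]; split=> //.
- by cnts.
- by lia.
- by cnts.
- by lia.
Qed.

(** Between two disjoint longest paths, a connection would join half of one to
    half of the other. *)
Lemma connected_longest_meet p q :
  (forall x A, path e x A -> uniq (x :: A) -> size A <= L) ->
  (forall x y, connect e x y) -> longest e L p -> longest e L q ->
  exists2 v, v \in p & v \in q.
Proof.
move=> bnd conn lp lq; apply: NNPP => no.
have [up _ szp] := lp; have [uq _ szq] := lq.
have [dj|//] := cnt_disj up uq.
have [a ap] : exists a, a \in p by case: (p) szp => // a p' _; exists a; apply: mem_head.
have [b bq] : exists b, b \in q by case: (q) szq => // b q' _; exists b; apply: mem_head.
have [A wA uA] : exists2 A, walk e a A b & uniq A.
  have /connectP[A' pA' bE] := conn a b.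
  by case/shortenP: pA' bE => A pA /andP[_ uA] _ ->; exists A.
have [u [A1 [A2 [E w1 w2 pu dA2]]]] := walk_last wA uA up ap.
have uA2 : uniq A2 by move: uA; rewrite E cat_uniq => /and3P[].
have ub : u != b.
  by apply/eqP => ub; case: no; exists b; rewrite -?ub // ub.
have bA2 := walk_end w2 ub.
have [|v [B1 [B2 [F w3 _ qv [vB1 dB1]]]]] := walk_first w2 uA2 uq.
  by exists b; rewrite // mem_cnt; have := bA2 b; rewrite eqxx.
have [C [c [wC cC hC]]] := longest_long_tail lp pu.
have [D [d [wD cD hD]]] := longest_long_tail lq qv.
have [C' [wC' sC' cC']] := walk_rev e_sym wC.
have [pW _] := walk_cat wC' (walk_cat w3 wD).
have B1_gt0 : 0 < size B1 by case: (B1) vB1 => //= /(_ v); rewrite eqxx.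
have : size (C' ++ B1 ++ D) <= L.
  apply: bnd pW _; apply/cnt_uniq.
  have c1p := longest_cnt lp; have c1q := longest_cnt lq.
  have cA2 w : cnt A2 w = cnt B1 w + cnt B2 w by rewrite F cnt_cat.
  by clear - dj c1p c1q cA2 dA2 dB1 vB1 cC cD cC'; cnts.
by rewrite !size_cat sC'; blia.
Qed.

End Decompositions.

Section LongestPaths.

Variables (T : finType) (e : rel T) (L : nat).
Hypothesis ce : counterexample e L.
Implicit Types (x y z u v w s t : T) (A B p q : seq T).

Let e_sym := ce_sym ce.

Lemma walk_bound x A y : walk e x A y -> (forall w, (x == w) + cnt A w <= 1) -> size A <= L.
Proof. by move=> [pA _] uA; apply: (ce_bound ce) pA _; apply/cnt_uniq => w; apply: uA. Qed.

Lemma walk_longest x A y : walk e x A y -> (forall w, (x == w) + cnt A w <= 1) ->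
  size A = L -> longest e L (x :: A).
Proof. by move=> [pA _] uA sA; split=> //; [apply/cnt_uniq => w; apply: uA | rewrite /= sA]. Qed.

(** Any half of a longest path meets every longest path: otherwise the other
    half leads to a vertex from which one can continue along at least half of
    that longest path. *)
Lemma longest_half x A s B t q : walk e x A s -> walk e x B t ->
  (forall w, (x == w) + cnt A w + cnt B w <= 1) -> size A + size B = L -> L <= 2 * size A ->
  longest e L q -> x \notin q -> exists2 v, v \in A & v \in q.
Proof.
move=> wA wB uAB sAB hA lq xq; apply: NNPP => no.
have [A' [wA' sA' cA']] := walk_rev e_sym wA.
have uA : uniq A by apply/cnt_uniq; cnts.
have uB : uniq B by apply/cnt_uniq; cnts.
have [uq _ _] := lq.
have cq1 := longest_cnt lq; have cxq := longest_notin lq xq.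
have [dAq|//] := cnt_disj uA uq.
have lAB : longest e L (s :: A' ++ B).
  by apply: walk_longest (walk_cat wA' wB) _ _; [cnts | rewrite size_cat sA'].
have [v vAB vq] := ce_meet ce lAB lq.
have vB : v \in B.
  by move: vAB vq; rewrite !mem_cnt; have := cxq v; have := cA' v; have := dAq v; spec_at v; lia.
have [|u [B1 [B2 [E w1 w2 uq' [c1 c2]]]]] := walk_first wB uB uq; first by exists v.
have [C [c [wC cC hC]]] := longest_long_tail e_sym lq uq'.
have B10 : 0 < size B1 by case: (B1) c1 => //= /(_ u); rewrite eqxx.
have := walk_bound (walk_cat wA' (walk_cat w1 wC)); rewrite !size_cat sA'.
rewrite {}E in uAB; suff: forall w, (s == w) + cnt (A' ++ B1 ++ C) w <= 1.
  by move=> /[swap]/[apply]; lia.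
by clear - uAB c1 c2 dAq cC cq1 cxq cA'; cnts.
Qed.

End LongestPaths.

(** [bound ce W as b] records that the walk [W] is no longer than a longest
    path, once [W] is seen to be free of repetitions. *)
Tactic Notation "bound" constr(ce) uconstr(W) "as" ident(b) "by" tactic3(tac) :=
  pose proof (walk_bound ce W) as b;
  let Q := fresh in
  match type of b with ?P -> _ => assert (Q : P) by (tac; cnts); specialize (b Q); clear Q end;
  rewrite ?size_cat in b.
Tactic Notation "bound" constr(ce) uconstr(W) "as" ident(b) :=
  bound ce W as b by idtac.

(** * Components of a separation *)

Section Separations.

Variables (T : finType) (e : rel T).
Hypothesis e_sym : symmetric e.
Implicit Types (x y z u v w s t : T) (A B p q : seq T) (C D : {set T}).

(** No edge leaves [D] but to [x] and [y]. The condition is kept weaker than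
    being a component since the regions of a triangle are unions of components. *)
Definition attached x y D : Prop :=
  forall v w, v \in D -> e v w -> [|| w \in D, w == x | w == y].

Definition component x y u : {set T} :=
  [set v | connect [rel a b | [&& e a b, a \notin [:: x; y] & b \notin [:: x; y]]] u v].

Lemma mem_component x y u : u \in component x y u.
Proof. by rewrite inE connect0. Qed.

Lemma component_avoid x y u : x != y -> u \notin [:: x; y] ->
  forall w, (w \in component x y u) + (x == w) + (y == w) <= 1.
Proof.
move=> xy uxy w; suff : w \in component x y u -> w \notin [:: x; y].
  rewrite !inE ![w == _]eq_sym; case: (connect _ _ _) => [/(_ isT)/norP[/negPf-> /negPf->]//|_].
  by case: eqVneq => [<-|_]; rewrite ?leq_b1 // eq_sym (negPf xy).
rewrite inE => /connectP[c pc ->]; case/lastP: c pc => // c a.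
by rewrite rcons_path last_rcons /= => /and4P[].
Qed.

Lemma component_attached x y u : x != y -> u \notin [:: x; y] -> attached x y (component x y u).
Proof.
move=> xy uxy v w vC evw; apply/orP; have [|wxy] := boolP (w \in [:: x; y]).
  by rewrite !inE; right.
left; have vxy : v \notin [:: x; y].
  by have := component_avoid xy uxy v; rewrite vC !inE ![v == _]eq_sym; do 2!case: (_ == v).
move: vC; rewrite !inE => /connect_trans; apply; apply: connect1 => /=.
by rewrite evw vxy wxy.
Qed.

Lemma component_min x y u D : attached x y D -> u \in D -> {subset component x y u <= D}.
Proof.
move=> clD uD v; rewrite inE => /connectP[c + ->].
elim: c u uD => //= a c IH u uD /andP[/and3P[eua _ axy] /IH]; apply.
by have := clD _ _ uD eua; move: axy; rewrite !inE; case: (a \in D) => //= /negPf->.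
Qed.

Lemma component_disjoint x y u v :
  component x y u = component x y v \/
  forall w, (w \in component x y u) + (w \in component x y v) <= 1.
Proof.
set r := [rel a b | [&& e a b, a \notin [:: x; y] & b \notin [:: x; y]]].
have rC : connect_sym r.
  by apply: sym_connect_sym => a b; rewrite /= e_sym andbA andbAC -andbA.
have [uv|uv] := boolP (connect r u v).
  by left; apply/setP => w; rewrite !inE (same_connect rC uv).
right=> w; rewrite !inE -/r.
case uw: (connect r u w); case vw: (connect r v w) => //; case/negP: uv.
by apply: connect_trans uw _; rewrite rC.
Qed.

Lemma attached_sym x y D : attached x y D -> attached y x D.
Proof. by move=> cD v w vD /cD-/(_ vD); rewrite [(w == x) || _]orbC. Qed.

(** A path can enter or leave [D] only through [x] or [y]. *)
Lemma attached_sorted x y D A : attached x y D -> sorted e A ->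
  (forall w, cnt A w + (x == w) + (y == w) <= 1) ->
  (forall w, cnt A w <= (w \in D)) \/ (forall w, cnt A w + (w \in D) <= 1).
Proof.
move=> cD; elim: A => [|a A IH]; first by right=> w; rewrite cnt_nil leq_b1.
move=> /= pA dA.
have axy := dA a; rewrite cnt_cons eqxx in axy.
case: A => [|b A] in IH pA dA axy *.
  have [aD|aD] := boolP (a \in D).
    by left=> w; rewrite cnt_cons cnt_nil; case: eqP => // <-; rewrite aD.
  right=> w; rewrite cnt_cons cnt_nil; case: eqP => [<-|_]; last exact: leq_b1.
  by rewrite (negPf aD).
have bxy := dA b; move: pA => /= /andP[eab pA]; rewrite !cnt_cons eqxx in bxy.
case: (IH pA) => [|inD|outD].
- by move=> w; have := dA w; rewrite !cnt_cons; lia.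
- have bD : b \in D by have := inD b; rewrite cnt_cons eqxx; case: (b \in D).
  have := cD b a bD; rewrite e_sym => /(_ eab).
  rewrite ![a == _]eq_sym => aD; left=> w; rewrite cnt_cons.
  case: (eqVneq a w) => [<-|_]; last exact: inD.
  by move: aD axy; case: (a \in D); case: (x == a); case: (y == a) => //=; lia.
- have bD : b \notin D by have := outD b; rewrite cnt_cons eqxx; case: (b \in D); lia.
  have [aD|aD] := boolP (a \in D).
    have := cD _ _ aD eab; rewrite (negPf bD) ![b == _]eq_sym /=.
    by move: bxy; case: (x == b); case: (y == b) => //=; lia.
  right=> w; rewrite cnt_cons; case: (eqVneq a w) => [<-|_]; last exact: outD.
  by rewrite (negPf aD); move: axy; rewrite cnt_cons; lia.
Qed.

Lemma attached_walk x y D s A t : attached x y D -> walk e s A t ->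
  (forall w, cnt A w + (x == w) + (y == w) <= 1) ->
  (forall w, cnt A w <= (w \in D)) \/ (forall w, cnt A w + (w \in D) <= 1).
Proof. by move=> cD [/path_sorted pA _]; apply: attached_sorted. Qed.

End Separations.

(** * Every separation has a component that captures the longest paths *)

Definition meet_in (T : finType) (D : {set T}) (p q : seq T) : Prop :=
  exists v, [/\ v \in p, v \in q & v \in D].

(** The first condition makes [D] the side of the separation to which the
    longest paths avoiding one of its vertices point; applied to a path
    avoiding both, it puts that path into [D]. The second condition concerns the
    paths through both [x] and [y], and without it several components could be
    eligible that longest paths through both vertices avoid. *)
Definition captures (T : finType) (e : rel T) (L : nat) (x y : T) (D : {set T}) : Prop :=
  (forall p q, longest e L p -> longest e L q -> y \notin p -> x \notin q ->
     meet_in D p q) /\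
  (forall p, longest e L p -> exists2 v, v \in p & v \in D).

Section Capturing.

Variables (T : finType) (e : rel T) (L : nat).
Hypothesis ce : counterexample e L.
Implicit Types (x y z u v w s t : T) (p q a b : seq T) (A B C D : {set T}).

Let longest := longest e L.
Let walk := walk e.
Let e_sym := ce_sym ce.

Lemma ce_gt0 (x : T) : 0 < L.
Proof.
have [p lp _] := ce_avoid ce x; rewrite lt0n; apply/eqP => L0.
have [_ _] := lp; rewrite L0; case: p lp => [//|v [|//]] lp _.
have [q lq vq] := ce_avoid ce v; have [w] := ce_meet ce lp lq.
by rewrite inE => /eqP->; rewrite (negPf vq).
Qed.

Lemma component_sym x y u : component e x y u = component e y x u.
Proof.
apply/setP => w; rewrite !inE; apply: eq_connect => a b.
by rewrite /= !inE ![_ || (_ == y)]orbC.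
Qed.

Lemma meet_inC D p q : meet_in D p q -> meet_in D q p.
Proof. by case=> v [*]; exists v. Qed.

(** [D] is the side of the separation on which at least half of [p] lies. The
    disjunction says so; the first clause is the consequence, by
    [longest_half], on which the choice of a capturing component rests. *)
Definition heavy x y p D :=
  (forall q, longest q -> x \notin q -> meet_in D p q) /\
  ((forall w, cnt p w <= (w \in D)) \/
   exists a s, [/\ walk x a s, forall w, cnt a w <= (w \in D) & L <= 2 * size a]).

Lemma heavy_component x y p : x != y -> longest p -> y \notin p ->
  exists2 u, u \notin [:: x; y] & heavy x y p (component e x y u).
Proof.
move=> xy lp yp; have cyp := longest_notin lp yp; have L0 := ce_gt0 x.
have [xp|xp] := boolP (x \in p); last first.
  have cxp := longest_notin lp xp; have nxy := neq_cnt xy; have [_ sp szp] := lp.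
  have [v vp] : exists v, v \in p by case: (p) szp => // v p' _; exists v; apply: mem_head.
  have vxy : v \notin [:: x; y].
    by rewrite !inE; apply/norP; split; apply: contraTN vp => /eqP->.
  have inD : forall w, cnt p w <= (w \in component e x y v).
    case: (attached_sorted e_sym (component_attached xy vxy) sp) => [|//|dis]; first by cnts.
    by have := dis v; rewrite mem_component; move: vp; rewrite mem_cnt; blia.
  exists v => //; split; last by left.
  move=> q lq _; have [w wp wq] := ce_meet ce lp lq; exists w; split=> //.
  exact: cnt_sub inD wp.
have [a [s [b [t [wa wb sab cp]]]]] := longest_at e_sym lp xp.
wlog ab : a s b t wa wb sab cp / size b <= size a.
  move=> H; have [ab|/ltnW ab] := leqP (size b) (size a); first exact: (H a s b t).
  by apply: (H b t a s) => //; [rewrite addnC | cnts].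
have up := longest_cnt lp.
have [u ua] : exists u, u \in a.
  by case: (a) sab ab => [|u a' _ _]; [rewrite /=; blia | exists u; apply: mem_head].
have ca : forall w, cnt a w + (x == w) + (y == w) <= 1 by cnts.
have uxy := avoid_notin ca ua.
have inD : forall w, cnt a w <= (w \in component e x y u).
  case: (attached_walk e_sym (component_attached xy uxy) wa ca) => [//|dis].
  by have := dis u; rewrite mem_component; move: ua; rewrite mem_cnt; blia.
exists u => //; split; last by right; exists a, s; split=> //; blia.
move=> q lq xq; have [||w wa' wq] := longest_half ce wa wb _ sab _ lq xq; first by cnts.
  by lia.
exists w; split=> //; first by move: wa'; rewrite !mem_cnt cp; blia.
exact: cnt_sub inD wa'.
Qed.

(** A path avoiding [y] can change sides at [x] only, hence at most once. *)
Lemma two_sides x y A B p : attached e x y A -> attached e x y B ->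
  (forall w, (w \in A) + (w \in B) + (x == w) + (y == w) <= 1) ->
  longest p -> y \notin p ->
  (exists2 v, v \in p & v \in A) -> (exists2 v, v \in p & v \in B) ->
  exists a s b t, [/\ walk x a s, walk x b t, size a + size b = L,
    (forall w, cnt a w <= (w \in A)) /\ (forall w, cnt b w <= (w \in B)) &
    forall w, cnt p w = (x == w) + cnt a w + cnt b w].
Proof.
move=> cA cB dAB lp yp [v vp vA] [u up uB].
have cyp := longest_notin lp yp; have c1 := longest_cnt lp.
have [_ sp _] := lp.
have [xp|xp] := boolP (x \in p); last first.
  have cxp := longest_notin lp xp.
  case: (attached_sorted e_sym cA sp) => [|H|H]; first by cnts.
  - by have := H u; move: up; have := dAB u; rewrite uB mem_cnt; blia.
  - by have := H v; move: vp; rewrite vA mem_cnt; blia.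
have [a [s [b [t [wa wb sab cp]]]]] := longest_at e_sym lp xp.
have ca : forall w, cnt a w + (x == w) + (y == w) <= 1 by cnts.
have cb : forall w, cnt b w + (x == w) + (y == w) <= 1 by cnts.
have := cp u; have := cp v; have := dAB u; have := dAB v; rewrite uB vA.
move: up vp; rewrite !mem_cnt => up vp dv du cv cu.
case: (attached_walk e_sym cA wa ca) => aA; case: (attached_walk e_sym cB wb cb) => bB.
- by exists a, s, b, t.
- case: (attached_walk e_sym cB wa ca) => aB; last by have := aB u; have := bB u; rewrite uB; blia.
  by have := aB u; have := aA u; have := bB u; rewrite uB; blia.
- case: (attached_walk e_sym cA wb cb) => bA; last by have := aA v; have := bA v; rewrite vA; blia.
  by have := aA v; have := bA v; have := bB v; rewrite vA; blia.
- case: (attached_walk e_sym cA wb cb) => bA; last by have := aA v; have := bA v; rewrite vA; blia.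
  case: (attached_walk e_sym cB wa ca) => aB; last by have := aB u; have := bB u; rewrite uB; blia.
  by exists b, t, a, s; split=> //; [rewrite addnC | cnts].
Qed.

Lemma disjoint_or_meet D p q : longest p -> longest q -> ~ meet_in D p q ->
  forall w, cnt p w + cnt q w + (w \in D) <= 2.
Proof.
move=> lp lq no w; have := longest_cnt lp w; have := longest_cnt lq w.
have [wp|] := boolP (w \in p); last by rewrite mem_cnt; blia.
have [wq|] := boolP (w \in q); last by rewrite [w \in q]mem_cnt; blia.
by have [wD|wD] := boolP (w \in D); [case: no; exists w | blia].
Qed.

(** If the two paths cross in [B] but not in [A], then joining them at a
    crossing gives a path between their ends in [A]; so their parts in [A] are
    short, and those in [B] are long. *)
Lemma crossing_tails x y A B p q a s b t a' s' b' t' :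
  (forall w, (w \in A) + (w \in B) + (x == w) + (y == w) <= 1) ->
  longest p -> longest q ->
  walk x a s -> walk x b t -> size a + size b = L ->
  (forall w, cnt a w <= (w \in A)) -> (forall w, cnt b w <= (w \in B)) ->
  (forall w, cnt p w = (x == w) + cnt a w + cnt b w) ->
  walk y a' s' -> walk y b' t' -> size a' + size b' = L ->
  (forall w, cnt a' w <= (w \in A)) -> (forall w, cnt b' w <= (w \in B)) ->
  (forall w, cnt q w = (y == w) + cnt a' w + cnt b' w) ->
  ~ meet_in A p q -> meet_in B p q -> L < size b + size b'.
Proof.
move=> dAB lp lq wa wb sab aA bB cp wa' wb' sab' aA' bB' cq no [v [vp vq vB]].
have dA := disjoint_or_meet lp lq no.
have p1 := longest_cnt lp; have q1 := longest_cnt lq.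
have ub : uniq b by apply/cnt_uniq; cnts.
have ub' : uniq b' by apply/cnt_uniq; cnts.
have vb : v \in b.
  by move: vp; rewrite !mem_cnt; have := aA v; have := dAB v; rewrite vB cp; blia.
have vb' : v \in b'.
  by move: vq; rewrite !mem_cnt; have := aA' v; have := dAB v; rewrite vB cq; blia.
have [|u [b1 [b2 [E w1 _ ub1 [c1 c2]]]]] := walk_first wb ub ub'; first by exists v.
have ub1' : u \in y :: b' by rewrite inE ub1 orbT.
have [b1' [b2' [E' w1' _ c1']]] := walk_split wb' ub1'.
have {}c1' : forall w, (u == w) <= cnt b1' w by move=> w; apply: c1'.
have [r [wr sr cr]] := walk_rev e_sym w1'.
have [ra [wra sra cra]] := walk_rev e_sym wa.
have b1_gt0 : 0 < size b1 by case: (b1) c1 => //= /(_ u); rewrite eqxx.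
rewrite {}E {}E' in sab sab' bB bB' cp cq c2 *.
bound ce (walk_cat wra (walk_cat w1 (walk_cat wr wa'))) as bnd.
by rewrite sr sra in bnd; move: sab sab'; rewrite !size_cat; lia.
Qed.

(** If a longest path through [x] and [y] avoids [D], then exchanging its ends
    against tails in [D] bounds these tails. *)
Lemma avoiding_tails x y D p a s b t : x != y -> longest p -> x \in p -> y \in p ->
  (forall w, cnt p w + (w \in D) <= 1) ->
  walk x a s -> (forall w, cnt a w <= (w \in D)) ->
  walk y b t -> (forall w, cnt b w <= (w \in D)) -> size a + size b < L.
Proof.
move=> xy lp xp yp pD wa aD wb bD.
have [A [s' [M [B [t' [wA wM wB sz [cp cy]]]]]]] := longest_at2 e_sym lp xp yp xy.
have [ra [wra sra cra]] := walk_rev e_sym wa.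
have [rA [wrA srA crA]] := walk_rev e_sym wA.
have M_gt0 : 0 < size M by case: (M) cy => //= /(_ y); rewrite eqxx.
bound ce (walk_cat wra (walk_cat wM wB)) as b1.
bound ce (walk_cat wrA (walk_cat wM wb)) as b2.
by lia.
Qed.

Lemma avoiding_heavy x y D p q r : x != y -> longest p -> longest q ->
  heavy x y p D -> heavy y x q D ->
  longest r -> x \in r -> y \in r -> (forall w, cnt r w + (w \in D) <= 1) -> False.
Proof.
move=> xy lp lq [_ hp] [_ hq] lr xr yr rD.
case: hp => [pD|[a [s [wa aD ha]]]].
  have [v vp vr] := ce_meet ce lp lr; have := cnt_sub pD vp => vD.
  by have := rD v; move: vr; rewrite vD mem_cnt; blia.
case: hq => [qD|[b [t [wb bD hb]]]].
  have [v vp vr] := ce_meet ce lq lr; have := cnt_sub qD vp => vD.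
  by have := rD v; move: vr; rewrite vD mem_cnt; blia.
by have := avoiding_tails xy lr xr yr rD wa aD wb bD; lia.
Qed.

Lemma not_captures x y D : ~ captures e L x y D ->
  (exists p q, [/\ longest p, longest q, y \notin p, x \notin q & ~ meet_in D p q]) \/
  (exists p, [/\ longest p, x \in p, y \in p & forall w, cnt p w + (w \in D) <= 1]).
Proof.
move=> nc; apply: NNPP => /not_or_and[no1 no2]; case: nc.
have pairs p q : longest p -> longest q -> y \notin p -> x \notin q -> meet_in D p q.
  by move=> lp lq yp xq; apply: NNPP => nm; case: no1; exists p, q.
split=> // p lp; apply: NNPP => no.
have [yp|yp] := boolP (y \in p); last first.
  have [q lq xq] := ce_avoid ce x.
  by have [v [vp _ vD]] := pairs p q lp lq yp xq; case: no; exists v.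
have [xp|xp] := boolP (x \in p); last first.
  have [q lq yq] := ce_avoid ce y.
  by have [v [_ vp vD]] := pairs q p lq lp yq xp; case: no; exists v.
case: no2; exists p; split=> // w; have := longest_cnt lp w.
have [wD|wD] := boolP (w \in D); last by blia.
have [wp|] := boolP (w \in p); first by case: no; exists w.
by rewrite mem_cnt; blia.
Qed.

(** If the heavy sides of all longest paths avoiding [x] or [y] agree, that
    side captures: a longest path through [x] and [y] avoiding it would have two
    ends of at least half of its length, by [avoiding_tails]. Otherwise some [p]
    and [q] have different heavy sides [A] and [B]; as they meet in both, only
    [A] and [B] matter. If neither captures, each fails for one of the two
    reasons of [not_captures]. Two failing pairs of paths have tails in [A] and
    in [B] that add up to more than [2 * L] ([crossing_tails]), although the
    tails at [x] and those at [y] can be joined; in the mixed cases,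
    [avoiding_heavy] applies; and if longest paths avoid [A] and [B],
    respectively, then [avoiding_tails] makes [p] and [q] together shorter than
    [2 * L]. *)
Lemma component_captures x y : x != y ->
  exists2 u, u \notin [:: x; y] & captures e L x y (component e x y u).
Proof.
move=> xy; have yx : y != x by rewrite eq_sym.
have swap u : u \notin [:: y; x] -> u \notin [:: x; y] by rewrite !inE orbC.
apply: NNPP => no.
have bad u : u \notin [:: x; y] -> ~ captures e L x y (component e x y u).
  by move=> uxy c; case: no; exists u.
have hP p : longest p -> y \notin p ->
    exists2 u, u \notin [:: x; y] & heavy x y p (component e x y u).
  exact: heavy_component.
have hQ q : longest q -> x \notin q ->
    exists2 u, u \notin [:: x; y] & heavy y x q (component e x y u).
  move=> lq xq; have [u /swap uxy hu] := heavy_component yx lq xq.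
  by exists u; rewrite // component_sym.
have [[p [q [u [v [[lp lq yp xq] [uxy vxy hp hq uv]]]]]]|same] := classic (exists p q u v,
    [/\ longest p, longest q, y \notin p & x \notin q] /\
    [/\ u \notin [:: x; y], v \notin [:: x; y], heavy x y p (component e x y u),
       heavy y x q (component e x y v) & component e x y u <> component e x y v]); last first.
  have [p lp yp] := ce_avoid ce y; have [q lq xq] := ce_avoid ce x.
  have [u uxy hp] := hP p lp yp; have [v vxy hq] := hQ q lq xq.
  have uv p' u' : longest p' -> y \notin p' -> u' \notin [:: x; y] ->
      heavy x y p' (component e x y u') -> component e x y u' = component e x y v.
    by move=> lp' yp' u'xy hp'; apply: NNPP => ne; case: same; exists p', q, u', v.
  case: (not_captures (bad v vxy)) => [[p' [q' [lp' lq' yp' xq' []]]]|[r [lr xr yr]]].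
    by have [u' u'xy hp'] := hP p' lp' yp'; rewrite -(uv _ _ lp' yp' u'xy hp'); apply: hp'.1.
  by apply: avoiding_heavy lr xr yr => //; [exact: lp | exact: lq | rewrite -(uv p u)|].
set A := component e x y u in hp uv; set B := component e x y v in hq uv.
have [//|dAB] := component_disjoint e_sym x y u v; rewrite -/A -/B in dAB.
have cA : attached e x y A by apply: component_attached.
have cB : attached e x y B by apply: component_attached.
have {}dAB : forall w, (w \in A) + (w \in B) + (x == w) + (y == w) <= 1.
  have dA := component_avoid e xy uxy; have dB := component_avoid e xy vxy.
  by have nxy := neq_cnt xy; rewrite -/A -/B in dA dB; cnts.
have dBA : forall w, (w \in A) + (w \in B) + (y == w) + (x == w) <= 1 by cnts.
have in2 D p' q' : meet_in D p' q' -> exists2 w, w \in p' & w \in D by case=> w [*]; exists w.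
have splitP p' : longest p' -> y \notin p' ->
    (exists2 w, w \in p' & w \in A) -> (exists2 w, w \in p' & w \in B) ->
    exists a s b t, [/\ walk x a s, walk x b t, size a + size b = L,
      (forall w, cnt a w <= (w \in A)) /\ (forall w, cnt b w <= (w \in B)) &
      forall w, cnt p' w = (x == w) + cnt a w + cnt b w].
  by move=> lp' yp'; apply: two_sides yp'.
have splitQ q' : longest q' -> x \notin q' ->
    (exists2 w, w \in q' & w \in A) -> (exists2 w, w \in q' & w \in B) ->
    exists a s b t, [/\ walk y a s, walk y b t, size a + size b = L,
      (forall w, cnt a w <= (w \in A)) /\ (forall w, cnt b w <= (w \in B)) &
      forall w, cnt q' w = (y == w) + cnt a w + cnt b w].
  by move=> lq' xq'; apply: two_sides xq' => //; apply: attached_sym.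
have mA := hp.1 q lq xq; have mB := meet_inC (hq.1 p lp yp).
have [a [s [b [t [wa wb sab [aA bB] cp]]]]] := splitP p lp yp (in2 _ _ _ mA) (in2 _ _ _ mB).
have [a' [s' [b' [t' [wa' wb' sab' [aA' bB'] cq]]]]] :=
  splitQ q lq xq (in2 _ _ _ (meet_inC mA)) (in2 _ _ _ (meet_inC mB)).
(* p and q only have vertices in A, B and the separation *)
have hPAB p' : longest p' -> y \notin p' -> heavy x y p' A \/ heavy x y p' B.
  move=> lp' yp'; have [u' u'xy hp'] := hP p' lp' yp'.
  have [w [wp' wq wu']] := hp'.1 q lq xq.
  have [uu'|d1] := component_disjoint e_sym x y u' u; first by left; rewrite /A -uu'.
  have [vu'|d2] := component_disjoint e_sym x y u' v; first by right; rewrite /B -vu'.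
  have := component_avoid e xy u'xy w; have := d1 w; have := d2 w; rewrite wu' -/A -/B.
  by move: wq; rewrite mem_cnt; have := aA' w; have := bB' w; rewrite cq; blia.
have hQAB q' : longest q' -> x \notin q' -> heavy y x q' A \/ heavy y x q' B.
  move=> lq' xq'; have [u' u'xy hq'] := hQ q' lq' xq'.
  have [w [wq' wp wu']] := hq'.1 p lp yp.
  have [uu'|d1] := component_disjoint e_sym x y u' u; first by left; rewrite /A -uu'.
  have [vu'|d2] := component_disjoint e_sym x y u' v; first by right; rewrite /B -vu'.
  have := component_avoid e xy u'xy w; have := d1 w; have := d2 w; rewrite wu' -/A -/B.
  by move: wp; rewrite mem_cnt; have := aA w; have := bB w; rewrite cp; blia.
case: (not_captures (bad u uxy)) => [[p2 [q2 [lp2 lq2 yp2 xq2 n2]]]|[r [lr xr yr rA]]];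
case: (not_captures (bad v vxy)) => [[p1 [q1 [lp1 lq1 yp1 xq1 n1]]]|[r' [lr' xr' yr' rB]]].
- have hp2 : heavy x y p2 B by case: (hPAB p2 lp2 yp2) => // h; case: n2; apply: h.1.
  have hq2 : heavy y x q2 B by case: (hQAB q2 lq2 xq2) => // h; case: n2; apply/meet_inC/h.1.
  have hp1 : heavy x y p1 A by case: (hPAB p1 lp1 yp1) => // h; case: n1; apply: h.1.
  have hq1 : heavy y x q1 A by case: (hQAB q1 lq1 xq1) => // h; case: n1; apply/meet_inC/h.1.
  have m21A := meet_inC (hq1.1 p2 lp2 yp2); have m21B := hp2.1 q1 lq1 xq1.
  have m12A := hp1.1 q2 lq2 xq2; have m12B := meet_inC (hq2.1 p1 lp1 yp1).
  have [a2 [? [b2 [? [wa2 wb2 sab2 [aA2 bB2] cp2]]]]] :=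
    splitP p2 lp2 yp2 (in2 _ _ _ m21A) (in2 _ _ _ m21B).
  have [a1 [? [b1 [? [wa1 wb1 sab1 [aA1 bB1] cp1]]]]] :=
    splitP p1 lp1 yp1 (in2 _ _ _ m12A) (in2 _ _ _ m12B).
  have [a2' [? [b2' [? [wa2' wb2' sab2' [aA2' bB2'] cq2]]]]] :=
    splitQ q2 lq2 xq2 (in2 _ _ _ (meet_inC m12A)) (in2 _ _ _ (meet_inC m12B)).
  have [a1' [? [b1' [? [wa1' wb1' sab1' [aA1' bB1'] cq1]]]]] :=
    splitQ q1 lq1 xq1 (in2 _ _ _ (meet_inC m21A)) (in2 _ _ _ (meet_inC m21B)).
  have sB : L < size b2 + size b2'.
    by apply: (crossing_tails dAB lp2 lq2 wa2 wb2 _ _ _ _ wa2' wb2') => //; apply: hp2.1.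
  have sA : L < size a1 + size a1'.
    apply: (@crossing_tails x y B A p1 q1 _ _ _ _ _ _ _ _ _
      lp1 lq1 wb1 wa1 _ _ _ _ wb1' wa1') => //.
    - by cnts.
    - by rewrite addnC.
    - by cnts.
    - by rewrite addnC.
    - by cnts.
    - exact: hp1.1.
  have [ra1 [wra1 sra1 cra1]] := walk_rev e_sym wa1.
  have [ra1' [wra1' sra1' cra1']] := walk_rev e_sym wa1'.
  bound ce (walk_cat wra1 wb2) as s1; bound ce (walk_cat wra1' wb2') as s2.
  by lia.
- have hp2 : heavy x y p2 B by case: (hPAB p2 lp2 yp2) => // h; case: n2; apply: h.1.
  have hq2 : heavy y x q2 B by case: (hQAB q2 lq2 xq2) => // h; case: n2; apply/meet_inC/h.1.
  exact: avoiding_heavy hp2 hq2 lr' xr' yr' rB.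
- have hp1 : heavy x y p1 A by case: (hPAB p1 lp1 yp1) => // h; case: n1; apply: h.1.
  have hq1 : heavy y x q1 A by case: (hQAB q1 lq1 xq1) => // h; case: n1; apply/meet_inC/h.1.
  exact: avoiding_heavy hp1 hq1 lr xr yr rA.
- have := avoiding_tails xy lr xr yr rA wa aA wa' aA'.
  by have := avoiding_tails xy lr' xr' yr' rB wb bB wb' bB'; lia.
Qed.

End Capturing.

(** * Crossings of two longest paths *)

(** A crossing of two longest paths, one through [x] and the other through
    [z], on the side [D] of the separation [x], [z]: [pd] and [qd] are their
    tails inside [D], [pr] and [qr] the remaining, outer parts. *)
Record crossing (T : finType) (e : rel T) (L : nat) (x z : T) (D : {set T})
    (pr pd qr qd : seq T) : Prop := {
  cr_pr : walk e x pr (last x pr);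
  cr_pd : walk e x pd (last x pd);
  cr_psize : size pr + size pd = L;
  cr_puniq : forall w : T, (x == w) + cnt pr w + cnt pd w <= 1;
  cr_qr : walk e z qr (last z qr);
  cr_qd : walk e z qd (last z qd);
  cr_qsize : size qr + size qd = L;
  cr_quniq : forall w : T, (z == w) + cnt qr w + cnt qd w <= 1;
  cr_in : forall w : T, (x == w) + (z == w) + (w \in D) <= 1;
  cr_prD : forall w : T, cnt pr w + (w \in D) <= 1;
  cr_pdD : forall w : T, cnt pd w <= (w \in D);
  cr_qrD : forall w : T, cnt qr w + (w \in D) <= 1;
  cr_qdD : forall w : T, cnt qd w <= (w \in D);
  cr_meet : exists2 v, v \in qd & v \in pd
}.

Section Crossings.

Variables (T : finType) (e : rel T) (L : nat).
Hypothesis ce : counterexample e L.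
Implicit Types (x y z u v w s t : T) (p q pr pd qr qd : seq T) (D : {set T}).

Let longest := longest e L.
Let walk := walk e.
Let e_sym := ce_sym ce.

(** At the first vertex [u] of the inner tail [qd] on [pd], the path coming from
    [z] may change to [pd]; this gives the inequality between the lengths. *)
Lemma crossingP x z D pr pd qr qd : crossing e L x z D pr pd qr qd ->
  exists u g1 g2 e1,
  [/\ pd = g1 ++ g2, walk x g1 u, walk u g2 (last x pd), walk z e1 u & 0 < size e1] /\
   [/\ size e1 + size g2 <= size qd, forall w, cnt g1 w + cnt g2 w <= (w \in D),
     forall w, cnt e1 w <= (w \in D), forall w, (u == w) <= cnt e1 w &
     forall w, (u == w) <= cnt g1 w /\ cnt e1 w + cnt g1 w + cnt g2 w <= 1 + (u == w)].
Proof.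
case=> [wpr wpd ps pu wqr wqd qs qu inD prD pdD qrD qdD m].
have uqd : uniq qd by apply/cnt_uniq; cnts.
have upd : uniq pd by apply/cnt_uniq; cnts.
have [u [e1 [e2 [E we1 we2 upd' [c1 c2]]]]] := walk_first wqd uqd upd m.
have ux : u \in x :: pd by rewrite inE upd' orbT.
have [g1 [g2 [F wg1 wg2 cg]]] := walk_split wpd ux.
have {}cg : forall w, (u == w) <= cnt g1 w by move=> w; apply: cg.
have e1_gt0 : 0 < size e1 by case: (e1) c1 => //= /(_ u); rewrite eqxx.
have [rq [wrq srq crq]] := walk_rev e_sym wqr.
rewrite {}F {}E in prD pdD qrD qdD pu qu c2 qs wg2 *.
exists u, g1, g2, e1; split=> //; split=> //.
- bound ce (walk_cat wrq (walk_cat we1 wg2)) as b.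
  by move: qs; rewrite !size_cat; lia.
- by cnts.
- by cnts.
- by move=> w; split; spec_at w; blia.
Qed.

(** The passage [g] of a longest path avoiding [D] could be exchanged against
    the one from [x] to [z] through the crossing in [D]; and the outer part of
    the path through [x] could be continued along [g] into the inner tail at
    [z]. Together with [crossingP], these bounds contradict each other. *)
Lemma no_bypass x z D pr pd qr qd a g b :
  crossing e L x z D pr pd qr qd ->
  walk x a (last x a) -> walk x g z -> walk z b (last z b) ->
  size a + size g + size b = L ->
  (forall w, (x == w) + cnt a w + cnt g w + cnt b w + (w \in D) <= 1) ->
  (forall w, (z == w) <= cnt g w) ->
  (forall w, cnt pr w + cnt g w <= 1) -> False.
Proof.
move=> cr wa wg wb sz uD zg prg.
have [u [g1 [g2 [e1 [[E wg1 wg2 we1 e1_gt0] [seg gD e1D ue ueg]]]]]] := crossingP cr.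
have ug w := (ueg w).1; have eg w := (ueg w).2.
case: cr => [wpr wpd ps pu wqr wqd qs qu inD prD pdD qrD qdD m].
have [ra [wra sra cra]] := walk_rev e_sym wa.
have [rp [wrp srp crp]] := walk_rev e_sym wpr.
have [re [wre sre cre]] := walk_rev e_sym we1.
bound ce (walk_cat wra (walk_cat wg1 (walk_cat wre wb))) as b1.
bound ce (walk_cat wrp (walk_cat wg wqd)) as b2.
by rewrite E size_cat in ps; lia.
Qed.

(** The tail [b] is at least as long as the inner tail at [z], against which it
    could be exchanged; but then the outer part at [x], continued through the
    crossing to [z] and along [b], is too long. *)
Lemma no_detour x z D pr pd qr qd a b :
  crossing e L x z D pr pd qr qd ->
  walk z a (last z a) -> walk z b (last z b) -> size a + size b = L ->
  (forall w, (z == w) + cnt a w + cnt b w + (w \in D) <= 1) ->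
  (forall w, cnt pr w + cnt b w + (x == w) + (z == w) <= 1) -> False.
Proof.
move=> cr wa wb sz uD prb.
have [u [g1 [g2 [e1 [[E wg1 wg2 we1 e1_gt0] [seg gD e1D ue ueg]]]]]] := crossingP cr.
have ug w := (ueg w).1; have eg w := (ueg w).2.
case: cr => [wpr wpd ps pu wqr wqd qs qu inD prD pdD qrD qdD m].
have [ra [wra sra cra]] := walk_rev e_sym wa.
have [rp [wrp srp crp]] := walk_rev e_sym wpr.
have [re [wre sre cre]] := walk_rev e_sym we1.
bound ce (walk_cat wra wqd) as b1.
bound ce (walk_cat wrp (walk_cat wg1 (walk_cat wre wb))) as b2.
by rewrite E size_cat in ps; lia.
Qed.

Lemma crossing_sym x z D pr pd qr qd :
  crossing e L x z D pr pd qr qd -> crossing e L z x D qr qd pr pd.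
Proof.
case=> [wpr wpd ps pu wqr wqd qs qu inD prD pdD qrD qdD [v vq vp]].
by split=> //; [cnts | exists v].
Qed.

End Crossings.

(** * Triangles of separations *)

(** [X], [Y] and [Z] are the regions between [x] and [y], between [y] and [z],
    and between [z] and [x]. The last three conditions say that for each
    separation by two vertices of the triangle, the side of the third vertex
    captures the longest paths. *)
Record triangle (T : finType) (e : rel T) (L : nat) (x y z : T) (X Y Z : {set T}) : Prop := {
  tr_part : forall w : T, (x == w) + (y == w) + (z == w) + (w \in X) + (w \in Y) + (w \in Z) = 1;
  tr_X : attached e x y X;
  tr_Y : attached e y z Y;
  tr_Z : attached e z x Z;
  tr_capX : captures e L x y (~: (X :|: [set x; y]));
  tr_capY : captures e L y z (~: (Y :|: [set y; z]));
  tr_capZ : captures e L z x (~: (Z :|: [set z; x]))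
}.

(** A longest path cut at two of its vertices, with its middle part inside the
    region between them. *)
Record through (T : finType) (e : rel T) (L : nat) (x y : T) (X : {set T})
    (p a m b : seq T) : Prop := {
  th_a : walk e x a (last x a);
  th_m : walk e x m y;
  th_b : walk e y b (last y b);
  th_size : size a + size m + size b = L;
  th_cnt : forall w : T, cnt p w = (x == w) + cnt a w + cnt m w + cnt b w;
  th_end : forall w : T, (y == w) <= cnt m w;
  th_side : forall w : T, cnt m w <= (w \in X) + (y == w)
}.

Section Triangles.

Variables (T : finType) (e : rel T) (L : nat).
Hypothesis ce : counterexample e L.
Implicit Types (x y z u v w s t : T) (p q a b m : seq T) (D X Y Z : {set T}).

Let longest := longest e L.
Let walk := walk e.
Let e_sym := ce_sym ce.
Let triangle := triangle e L.
Let through := through e L.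

Lemma captures_sym x y D : captures e L x y D -> captures e L y x D.
Proof. by case=> h1 h2; split=> // p q lp lq xp yq; apply/meet_inC/h1. Qed.

Lemma triangle_rot x y z X Y Z : triangle x y z X Y Z -> triangle y z x Y Z X.
Proof. by case=> part aX aY aZ cX cY cZ; split=> //; cnts. Qed.

Lemma triangle_swap x y z X Y Z : triangle x y z X Y Z -> triangle y x z X Z Y.
Proof.
case=> part aX aY aZ cX cY cZ; split; try exact: attached_sym.
- by cnts.
- by rewrite [[set y; x]]setUC; apply: captures_sym.
- by rewrite [[set x; z]]setUC; apply: captures_sym.
- by rewrite [[set z; y]]setUC; apply: captures_sym.
Qed.

Lemma triangle_neq x y z X Y Z : triangle x y z X Y Z -> x != y.
Proof. by case=> part *; apply/eqP => xy; have := part x; rewrite -xy eqxx; lia. Qed.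

Lemma outside x y X v : v \in ~: (X :|: [set x; y]) -> (v \in X) + (x == v) + (y == v) = 0.
Proof. by rewrite !inE ![v == _]eq_sym; case: (v \in X) (x == v) (y == v) => [] [] []. Qed.

Lemma in_captures x y X p q : captures e L x y (~: (X :|: [set x; y])) ->
  longest p -> longest q -> y \notin p -> x \notin q ->
  exists v, [/\ 0 < cnt p v, 0 < cnt q v & (v \in X) + (x == v) + (y == v) = 0].
Proof.
move=> [cap _] lp lq yp xq; have [v [vp vq /outside vX]] := cap p q lp lq yp xq.
by exists v; rewrite -!mem_cnt.
Qed.

Lemma all_captures x y X p : captures e L x y (~: (X :|: [set x; y])) ->
  longest p -> exists2 v, 0 < cnt p v & (v \in X) + (x == v) + (y == v) = 0.
Proof.
move=> [_ cap] lp; have [v vp /outside vX] := cap p lp.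
by exists v; rewrite -?mem_cnt.
Qed.

(** A region can be left through the triangle only, and [x] has no neighbour in
    the region opposite to it. *)
Lemma tail_sides x y z X Y Z a s : triangle x y z X Y Z -> walk x a s ->
  (forall w, cnt a w + (x == w) + (y == w) + (z == w) <= 1) ->
  (forall w, cnt a w <= (w \in X)) \/ (forall w, cnt a w <= (w \in Z)).
Proof.
move=> [part aX aY aZ _ _ _] wa ua.
case: (attached_walk e_sym aX wa) => [||outX]; [by cnts | by left |].
case: (attached_walk e_sym aZ wa) => [||outZ]; [by cnts | by right |].
case: a wa ua outX outZ => [|c a] wa ua outX outZ; first by left.
have cY : c \in Y.
  have := part c; have := ua c; have := outX c; have := outZ c.
  by rewrite !cnt_cons eqxx; case: (c \in Y); rewrite // ; blia.
have := aY c x cY; rewrite e_sym; case: wa => /= /andP[-> _] _ /(_ isT).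
have := part x; rewrite eqxx ![x == _]eq_sym.
by case: (x \in Y); case: (y == x); case: (z == x); rewrite //=; blia.
Qed.

Lemma mid_side x y z X Y Z m : triangle x y z X Y Z -> walk x m y ->
  (forall w, cnt m w + (x == w) + (z == w) <= 1) ->
  forall w, cnt m w <= (w \in X) + (y == w).
Proof.
move=> tr; case/lastP: m => [|m c]; first by move=> _ _ w; rewrite cnt_nil.
case=> + lc; rewrite rcons_path -cats1; move: lc; rewrite last_rcons => ->.
move=> /andP[pm ey] um.
have wm : walk x m (last x m) by [].
case: (tail_sides tr wm) => [|mX|mZ]; first by have part := tr_part tr; cnts.
  by cnts.
case: m pm ey um wm mZ => [|c' m] pm ey um wm mZ; first by cnts.
have lZ := cnt_sub mZ (mem_last c' m).
have := tr_Z tr lZ (ey : e (last c' m) y); have := tr_part tr y; rewrite eqxx ![y == _]eq_sym.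
by case: (y \in Z); case: (x == y); case: (z == y); rewrite //=; blia.
Qed.

Lemma through_sides x y z X Y Z p : triangle x y z X Y Z -> longest p ->
  x \in p -> y \in p -> z \notin p ->
  exists a m b, [/\ through x y X p a m b,
    (forall w, cnt a w <= (w \in X)) \/ (forall w, cnt a w <= (w \in Z)) &
    (forall w, cnt b w <= (w \in X)) \/ (forall w, cnt b w <= (w \in Y))].
Proof.
move=> tr lp xp yp zp; have part := tr_part tr.
have xy := triangle_neq tr.
have c1 := longest_cnt lp; have cz := longest_notin lp zp.
have [a [s [m [b [t [wa wm wb sz [cp cy]]]]]]] := longest_at2 e_sym lp xp yp xy.
exists a, m, b; split.
- split=> //; first by case: wa.
  + by case: wb.
  + by apply: (mid_side tr wm); cnts.
- by apply: (tail_sides tr wa); cnts.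
- by apply: (tail_sides (triangle_swap tr) wb); cnts.
Qed.

(** A path that meets the triangle in [x] only cannot have both tails in the
    same region, since it would then miss a side that captures. *)
Lemma single_tails x y z X Y Z p : triangle x y z X Y Z -> longest p ->
  y \notin p -> z \notin p ->
  exists a b, [/\ walk x a (last x a), walk x b (last x b), size a + size b = L,
    (forall w, cnt a w <= (w \in X)) /\ (forall w, cnt b w <= (w \in Z)) &
    forall w, cnt p w = (x == w) + cnt a w + cnt b w].
Proof.
move=> tr lp yp zp; have [part aX aY aZ capX capY capZ] := tr.
have cy := longest_notin lp yp; have cz := longest_notin lp zp.
have c1 := longest_cnt lp; have [_ sp _] := lp.
have xy w : (x == w) + (y == w) + (z == w) <= 1 by have := part w; blia.
have [xp|xp] := boolP (x \in p); last first.
  have cx := longest_notin lp xp.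
  have [v vp vX] := all_captures capX lp; have [v' vp' vX'] := all_captures capY lp.
  have [v'' vp'' vX''] := all_captures capZ lp.
  case: (attached_sorted e_sym aX sp) => [|iX|oX]; [by cnts|by have := iX v; blia|].
  case: (attached_sorted e_sym aY sp) => [|iY|oY]; [by cnts|by have := iY v'; blia|].
  case: (attached_sorted e_sym aZ sp) => [|iZ|oZ]; [by cnts|by have := iZ v''; blia|].
  by have := part v; have := oX v; have := oY v; have := oZ v; have := cx v;
     have := cy v; have := cz v; blia.
have [a [s [b [t [wa wb sab cp]]]]] := longest_at e_sym lp xp.
have wa' : walk x a (last x a) by case: wa.
have wb' : walk x b (last x b) by case: wb.
have [v vp vX] := all_captures capX lp; have [v' vp' vX'] := all_captures capZ lp.
case: (tail_sides tr wa) => [|aX'|aZ']; first by cnts.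
- case: (tail_sides tr wb) => [|bX'|bZ']; first by cnts.
  + by have := cp v; have := aX' v; have := bX' v; blia.
  + by exists a, b.
- case: (tail_sides tr wb) => [|bX'|bZ']; first by cnts.
  + by exists b, a; split=> //; [rewrite addnC | cnts].
  + by have := cp v'; have := aZ' v'; have := bZ' v'; blia.
Qed.

Lemma tail_component x y z X Y Z a : triangle x y z X Y Z -> walk x a (last x a) ->
  0 < size a -> (forall w, cnt a w <= (w \in Z)) ->
  let D := component e x z (head x a) in
  [/\ attached e x z D, forall w, (w \in D) <= (w \in Z), forall w, cnt a w <= (w \in D) &
     head x a \in Z].
Proof.
move=> tr wa a_gt0 aZ D; have part := tr_part tr.
have xz : x != z by rewrite eq_sym; apply: triangle_neq (triangle_rot (triangle_rot tr)).
have ha : head x a \in a by case: (a) a_gt0 => // u s _; apply: mem_head.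
have hZ := cnt_sub aZ ha.
have aavoid : forall w, cnt a w + (x == w) + (z == w) <= 1 by clear - aZ part; cnts.
have hxz := avoid_notin aavoid ha.
have aD : attached e x z D by apply: component_attached.
have DZ w : w \in D -> w \in Z.
  by apply: (component_min _ hZ); apply/attached_sym/(tr_Z tr).
split=> // w; first by case wD: (w \in D); rewrite // DZ.
move: w; case: (attached_walk e_sym aD wa aavoid) => // out.
by have := out (head x a); rewrite mem_component; move: ha; rewrite mem_cnt; blia.
Qed.

End Triangles.

(** * A longest path with a single vertex on the triangle *)

Section SingleClass.

Variables (T : finType) (e : rel T) (L : nat).
Hypothesis ce : counterexample e L.
Implicit Types (u v w s t : T) (p q r a b m : seq T) (D : {set T}).

Let longest := longest e L.
Let walk := walk e.
Let e_sym := ce_sym ce.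
Let through := through e L.

Variables (x y z : T) (X Y Z : {set T}) (p px pz : seq T).
Hypothesis tr : triangle e L x y z X Y Z.
Hypothesis lp : longest p.
Hypothesis yp : y \notin p.
Hypothesis zp : z \notin p.
Hypothesis wpx : walk x px (last x px).
Hypothesis wpz : walk x pz (last x pz).
Hypothesis sp : size px + size pz = L.
Hypothesis pxX : forall w, cnt px w <= (w \in X).
Hypothesis pzZ : forall w, cnt pz w <= (w \in Z).
Hypothesis cp : forall w, cnt p w = (x == w) + cnt px w + cnt pz w.

(** The path [q] meets [p] outside [X], hence in [pz], and outside [Z], hence in
    [px]; avoiding [x], it can get from one to the other through [y] and [z]
    only. *)
Lemma opposite_sides q : longest q -> x \notin q ->
  exists a m b, [/\ through y z Y q a m b, forall w, cnt a w <= (w \in X),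
    forall w, cnt b w <= (w \in Z) & exists2 v, v \in b & v \in pz].
Proof.
move=> lq xq; have [part aX aY aZ capX capY capZ] := tr.
have cxq := longest_notin lq xq; have c1 := longest_cnt lq; have [_ sq _] := lq.
have [v [vp vq vX]] := in_captures capX lp lq yp xq.
have [u [uq up uZ]] := in_captures capZ lq lp xq zp.
have vpz : 0 < cnt pz v by have := cp v; have := pxX v; blia.
have upx : 0 < cnt px u by have := cp u; have := pzZ u; blia.
have vZ := pzZ v; have uX := pxX u; have pu := part u; have pv := part v.
have zq : z \in q.
  apply/negPn/negP => zq; have czq := longest_notin lq zq.
  case: (attached_sorted e_sym aZ sq) => [|iZ|oZ]; first by cnts.
    by have := iZ u; blia.
  by have := oZ v; blia.
have yq : y \in q.
  apply/negPn/negP => yq; have cyq := longest_notin lq yq.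
  case: (attached_sorted e_sym aX sq) => [|iX|oX]; first by cnts.
    by have := iX v; blia.
  by have := oX u; blia.
have [a [m [b [th sa sb]]]] := through_sides ce (triangle_rot tr) lq yq zq xq.
have cu := th_cnt th u; have cv := th_cnt th v.
have mu := th_side th u; have mv := th_side th v.
have bZ : forall w, cnt b w <= (w \in Z).
  case: sb => // bY; have := bY v; case: sa => aS; have := aS v; blia.
have aX' : forall w, cnt a w <= (w \in X).
  case: sa => // aY'; have := aY' u; have := bZ u; blia.
exists a, m, b; split=> //; exists v; rewrite mem_cnt //.
by have := aX' v; blia.
Qed.

Let D := component e x z (head x pz).

Lemma inner_component : [/\ attached e x z D,
  forall w, (w \in D) <= (w \in Z), forall w, cnt pz w <= (w \in D) & head x pz \in Z].
Proof.
have [q lq xq] := ce_avoid ce x.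
have [? [? [? [_ _ _ [v _ vpz]]]]] := opposite_sides lq xq.
by apply: (tail_component ce tr wpz _ pzZ); case: (pz) vpz.
Qed.

(** The tail of [q] at [z] meets [pz], so it lies in the same component [D] as
    [pz]: the paths [p] and [q] cross in [D]. *)
Lemma opposite_inner q : longest q -> x \notin q ->
  exists a m b n, [/\ through y z Y q a m b, forall w, cnt a w <= (w \in X),
    forall w, cnt b w <= (w \in D), walk z n y &
    [/\ size n = size m, forall w, cnt n w + (z == w) = (y == w) + cnt m w &
      crossing e L x z D px pz (n ++ a) b]].
Proof.
move=> lq xq; have [a [m [b [th aX bZ [v vb vpz]]]]] := opposite_sides lq xq.
have [aD DZ pzD _] := inner_component.
have part := tr_part tr; have c1 := longest_cnt lq; have c2 := longest_cnt lp.
have xz : x != z by rewrite eq_sym; apply: triangle_neq (triangle_rot (triangle_rot tr)).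
have [wa wm wb sz cq zm mY] := th.
have bD : forall w, cnt b w <= (w \in D).
  case: (attached_walk e_sym aD wb) => // [|out]; first by clear - bZ part; cnts.
  by have := out v; have := pzD v; move: vb vpz; rewrite !mem_cnt; blia.
have [n [wn sn cn]] := walk_rev e_sym wm.
exists a, m, b, n; split=> //; split=> //; split=> //.
- by clear - c2 cp; cnts.
- by have := walk_cat wn wa; rewrite last_cat; case: (wn) => _ ->.
- by rewrite size_cat sn; lia.
- by clear - cn cq c1; cnts.
- by clear - part DZ; cnts.
- by clear - part pxX DZ; cnts.
- by clear - cn aX mY part DZ; cnts.
- by exists v.
Qed.

(** A part of [p] inside [Z] connects [r] and [q]. Leaving [q] for [r] along it,
    or the other way round, both paths could get a new end; that neither of
    them becomes longer is contradictory. *)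
Lemma inner_meet_Z r q a m b rx c ry :
  through y z Y q a m b -> (forall w, cnt a w <= (w \in X)) ->
  (forall w, cnt b w <= (w \in D)) -> (exists2 v, v \in pz & v \in b) ->
  through x y X r rx c ry -> (forall w, cnt rx w <= (w \in Z)) ->
  (forall w, cnt ry w <= (w \in X)) \/ (forall w, cnt ry w <= (w \in Y)) ->
  longest q -> longest r -> x \notin q -> z \notin r -> ~ meet_in D r q -> False.
Proof.
move=> [wa wm wb sz cq zm mY] aX bD mt [wrx wc wry szr cr yc cX] rxZ ryXY lq lr xq zr nm.
have [aD DZ pzD _] := inner_component.
have cxq := longest_notin lq xq; have czr := longest_notin lr zr.
have c1q := longest_cnt lq; have c1r := longest_cnt lr; have c1p := longest_cnt lp.
have dj := disjoint_or_meet lr lq nm.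
have ub : uniq b by apply/cnt_uniq; clear - c1q cq; cnts.
have upz : uniq pz by apply/cnt_uniq; clear - c1p cp; cnts.
(* the connection between r and q: the first vertex u of p in Z that is on q, and
   the last vertex v of r before u *)
have [u [g1 [g2 [E wg1 wg2 ub' [ug1 gb]]]]] := walk_first wpz upz ub mt.
have uzb : u \in z :: b by rewrite inE ub' orbT.
have [e1 [e2 [F we1 we2 ue1]]] := walk_split wb uzb.
have {}ue1 : forall w, (u == w) <= cnt e1 w by move=> w; apply: ue1.
have uxr : uniq (x :: rx) by apply/cnt_uniq; clear - c1r cr; cnts.
have ug : uniq g1 by move: upz; rewrite E cat_uniq => /andP[].
have [v [h1 [h2 [G wh1 wh2 vr hr]]]] := walk_last wg1 ug uxr (mem_head x rx).
have [s1 [s2 [H ws1 ws2 vs1]]] := walk_split wrx vr.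
have part := tr_part tr.
have vs : forall w, (v == w) + cnt s2 w <= (x == w) + cnt rx w.
  move=> w; move: vr; rewrite inE H cnt_cat => /orP[/eqP->|vr]; first by blia.
  by have := vs1 w; rewrite H => /(_ vr); blia.
have h2_gt0 : 0 < size h2.
  case: (h2) wh2 vr => // -[_ /= vu]; rewrite {}vu => ur.
  have := dj u; have := bD u; have := cr u; have := cq u; have := c1q u.
  have := part u; have := DZ u; have := cxq u.
  by move: ub' ur; rewrite mem_cnt inE mem_cnt eq_sym; case: (x == u) => /=; blia.
have [f2 [wf2 sf2 cf2]] := walk_rev e_sym we2.
have [k2 [wk2 sk2 ck2]] := walk_rev e_sym wh2.
have [t1 [wt1 st1 ct1]] := walk_rev e_sym ws1.
have [t2 [wt2 st2 ct2]] := walk_rev e_sym ws2.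
have [f1 [wf1 sf1 cf1]] := walk_rev e_sym we1.
have [n [wn sn cn]] := walk_rev e_sym wm.
have ryZ : forall w, cnt ry w + (w \in Z) <= 1.
  by case: ryXY => S; clear - S part; cnts.
have cpz w : cnt pz w = cnt h1 w + cnt h2 w + cnt g2 w by rewrite E G !cnt_cat.
have cg1 w : cnt g1 w = cnt h1 w + cnt h2 w by rewrite G cnt_cat.
have cb w : cnt b w = cnt e1 w + cnt e2 w by rewrite F cnt_cat.
have crx w : cnt rx w = cnt s1 w + cnt s2 w by rewrite H cnt_cat.
clear vs1.
(* the end of q beyond u, back along p to v, and along r through x and y *)
bound ce (walk_cat wf2 (walk_cat wk2 (walk_cat wt1 (walk_cat wc wry)))) as b1.
(* the end of r beyond v, along p to u, and along q through z and y *)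
bound ce (walk_cat wt2 (walk_cat wh2 (walk_cat wf1 (walk_cat wn wa)))) as b2.
by rewrite F H !size_cat in sz szr *; blia.
Qed.

(** The case of interest is [r] through [x] and [y]. If [r] starts from [x] into
    [Z], [inner_meet_Z] applies. Otherwise [r], continued from [y] along [q] into
    [D], shows that its tail at [y] is long. If this tail is in [Y], together with
    the tail of [q] in [X] it is a longest path with only [y] on the triangle, in
    conflict with [opposite_sides]; if it is in [X], then [r] stays in [X], and
    the side of [z] does not capture. *)
Lemma inner_meet r q : longest r -> longest q -> z \notin r -> x \notin q -> meet_in D r q.
Proof.
move=> lr lq zr xq; have [part aX aY aZ capX capY capZ] := tr.
have [aD DZ pzD _] := inner_component.
have [a [m [b [n [th qaX bD wn [sn cn cr]]]]]] := opposite_inner lq xq.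
have [wa wm wb sz cq zm mY] := th.
have czr := longest_notin lr zr; have c1r := longest_cnt lr.
have c1q := longest_cnt lq; have cxq := longest_notin lq xq.
have xr : x \in r.
  apply/negPn/negP => xr; have [? [m' [? [th' _ _ _]]]] := opposite_sides lr xr.
  by have := th_cnt th' z; have := th_end th' z; have := czr z; rewrite eqxx; blia.
apply: NNPP => nm; have dj := disjoint_or_meet lr lq nm.
have [yr|yr] := boolP (y \in r); last first.
  have cyr := longest_notin lr yr.
  have [rX [rZ [_ _ _ [rXX rZZ] crr]]] := single_tails ce tr lr yr zr.
  have [v [vr vq vX]] := in_captures capX lr lq yr xq.
  have := dj v; have := cq v; have := qaX v; have := mY v; have := bD v.
  by have := crr v; have := rXX v; have := rZZ v; have := part v; have := czr v; blia.
have [rx [c [ry [thr rxS ryS]]]] := through_sides ce tr lr xr yr zr.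
case: rxS => [rxX|rxZ]; last first.
  have [v vb vz] := cr_meet cr.
  apply: inner_meet_Z th qaX bD _ thr rxZ ryS lq lr xq zr nm.
  by exists v.
have [wrx wc wry szr crr yc cX] := thr.
have [t1 [wt1 st1 ct1]] := walk_rev e_sym wrx.
have ryL : size m + size b <= size ry.
  bound ce (walk_cat wt1 (walk_cat wc (walk_cat wm wb))) as b1; blia.
case: ryS => [ryX|ryY].
  have [v vr vX] := all_captures capX lr.
  by have := crr v; have := rxX v; have := cX v; have := ryX v; blia.
have [t2 [wt2 st2 ct2]] := walk_rev e_sym wa.
have wl := walk_cat wt2 wry.
have ul : forall w, (last y a == w) + cnt (t2 ++ ry) w <= 1.
  by clear - ct2 qaX ryY part c1q cq crr c1r yc; cnts.
have bl := walk_bound ce wl ul; rewrite size_cat st2 in bl.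
have ll : longest (last y a :: t2 ++ ry).
  by apply: (walk_longest wl ul); rewrite size_cat; blia.
have lx : x \notin last y a :: t2 ++ ry.
  by apply: notin_cnt; clear - ct2 qaX ryY part c1q cq crr c1r yc; cnts.
have lz : z \notin last y a :: t2 ++ ry.
  by apply: notin_cnt; clear - ct2 qaX ryY part c1q cq crr c1r yc; cnts.
have [? [m' [? [th' _ _ _]]]] := opposite_sides ll lx.
have := th_cnt th' z; have := th_end th' z; have := longest_notin ll lz z.
by rewrite eqxx; blia.
Qed.

(** A longest path avoiding [D] passes through [x] and [z] by [inner_meet]. If [y]
    is not between them, its passage from [x] to [z] is inside [Z], and
    [no_bypass] applies; otherwise its tail at [z] is outside [X], and
    [no_detour] applies. *)
Lemma inner_all r : longest r -> exists2 v, v \in r & v \in D.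
Proof.
move=> lr; apply: NNPP => no; have part := tr_part tr.
have [aD DZ pzD _] := inner_component.
have c1r := longest_cnt lr.
have rD w : cnt r w + (w \in D) <= 1.
  have := c1r w; have [wD|_] := boolP (w \in D); last by blia.
  have [wr|] := boolP (w \in r); first by case: no; exists w.
  by rewrite mem_cnt; blia.
have [q lq xq] := ce_avoid ce x.
have zr : z \in r.
  apply/negPn/negP => zr; have [v [vr _ vD]] := inner_meet lr lq zr xq.
  by case: no; exists v.
have xr : x \in r.
  apply/negPn/negP => xr; have [? [? [b' [? [th' _ bD' _ [_ _ cr']]]]]] := opposite_inner lr xr.
  have [v vb _] := cr_meet cr'; move: vb; rewrite mem_cnt.
  by have := th_cnt th' v; have := bD' v; have := rD v; blia.
have xz : x != z by rewrite eq_sym; apply: triangle_neq (triangle_rot (triangle_rot tr)).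
have [a [m [b [n [th qaX bD wn [sn cn cr]]]]]] := opposite_inner lq xq.
have [a' [s [g [b' [t [wa' wg wb' sz' [cr' gz]]]]]]] := longest_at2 e_sym lr xr zr xz.
have wa'' : walk x a' (last x a') by case: wa'.
have wb'' : walk z b' (last z b') by case: wb'.
have [yg|yg] := boolP (y \in g).
  have [n' [wn' sn' cn']] := walk_rev e_sym wg.
  have wna := walk_cat wn' wa''.
  have yg' := cnt_ge1 yg.
  apply: (no_detour ce cr (a := n' ++ a') (b := b')) => //.
  - by move: wna; rewrite last_cat; case: (wn') => _ ->.
  - by rewrite size_cat sn'; blia.
  - by clear - cn' cr' c1r rD; cnts.
  - case: (tail_sides ce (triangle_rot (triangle_rot tr)) wb') => [|S|S].
    + by clear - yg' cr' c1r gz part; cnts.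
    + by clear - S pxX part; cnts.
    + by clear - S pxX part; cnts.
have yg' : forall w, cnt g w + (x == w) + (y == w) <= 1.
  have ug : uniq g by apply/cnt_uniq; clear - c1r cr'; cnts.
  have cyg := cnt_notin ug yg; have := neq_cnt (triangle_neq tr).
  by move=> nxy; clear - nxy cyg cr' c1r; cnts.
have gZ := mid_side ce (triangle_swap (triangle_rot (triangle_rot tr))) wg yg'.
apply: (no_bypass ce cr wa'' wg wb'' _ _ gz) => //.
- by clear - cr' c1r rD; cnts.
- by clear - gZ pxX part; cnts.
Qed.

End SingleClass.

Lemma single_captures (T : finType) (e : rel T) (L : nat) (x y z : T) (X Y Z : {set T}) p :
  counterexample e L -> triangle e L x y z X Y Z -> longest e L p ->
  y \notin p -> z \notin p -> exists2 u, u \in Z & captures e L x z (component e x z u).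
Proof.
move=> ce tr lp yp zp.
have [px [pz [wpx wpz sp [pxX pzZ] cp]]] := single_tails ce tr lp yp zp.
exists (head x pz).
  by case: (inner_component ce tr lp yp zp wpz sp pxX pzZ cp).
split.
- by move=> r q lr lq zr xq; apply: (inner_meet ce tr lp yp zp wpx wpz sp).
- by move=> r lr; apply: (inner_all ce tr lp yp zp wpx wpz sp).
Qed.

(** * Longest paths with at least two vertices on the triangle *)

(** A longest path with exactly the vertices [x] and [y] on the triangle. *)
Record two_class (T : finType) (e : rel T) (L : nat) (x y z : T) (X Y Z : {set T})
    (p a m b : seq T) : Prop := {
  tc_longest : longest e L p;
  tc_notin : z \notin p;
  tc_through : through e L x y X p a m b;
  tc_a : (forall w, cnt a w <= (w \in X)) \/ (forall w, cnt a w <= (w \in Z));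
  tc_b : (forall w, cnt b w <= (w \in X)) \/ (forall w, cnt b w <= (w \in Y))
}.

Section TwoClasses.

Variables (T : finType) (e : rel T) (L : nat).
Hypothesis ce : counterexample e L.
Implicit Types (x y z u v w s t : T) (p q r a b m : seq T) (D X Y Z : {set T}).

Let longest := longest e L.
Let walk := walk e.
Let e_sym := ce_sym ce.
Let triangle := triangle e L.
Let two_class := two_class e L.

Definition no_single x y z := [/\ forall p, longest p -> y \notin p -> z \notin p -> False,
  forall p, longest p -> z \notin p -> x \notin p -> False &
  forall p, longest p -> x \notin p -> y \notin p -> False].

Lemma no_single_rot x y z : no_single x y z -> no_single y z x.
Proof. by case. Qed.

Lemma through_gt0 x y X p a m b : through e L x y X p a m b -> 0 < size m.
Proof. by case=> _ _ _ _ _ ym _; case: (m) ym => //= /(_ y); rewrite eqxx. Qed.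

Lemma two_classP x y z X Y Z p : triangle x y z X Y Z -> no_single x y z ->
  longest p -> z \notin p -> exists a m b, two_class x y z X Y Z p a m b.
Proof.
move=> tr [hx hy hz] lp zp.
have xp : x \in p by apply/negPn/negP => xp; apply: hy lp zp xp.
have yp : y \in p by apply/negPn/negP => yp; apply: hx lp yp zp.
have [a [m [b [th sa sb]]]] := through_sides ce tr lp xp yp zp.
by exists a, m, b.
Qed.

Lemma class_cnt x y z X Y Z p a m b : two_class x y z X Y Z p a m b ->
  forall w, (x == w) + cnt a w + cnt m w + cnt b w + (z == w) <= 1.
Proof.
move=> [lp zp [_ _ _ _ cp _ _] _ _] w; have := longest_notin lp zp w.
by rewrite cp; blia.
Qed.

(** If [r], passing through [x] and [y], and [q], passing through [y] and [z], do
    not meet in [Z], then each of them may be continued from [y] along the other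
    one; hence their tails at [y] are long. These tails meet, as otherwise their
    union would be a longest path with only [y] on the triangle. *)
Lemma exchange x y z X Y Z r rx c ry q qy b qz :
  triangle x y z X Y Z -> no_single x y z ->
  two_class x y z X Y Z r rx c ry -> two_class y z x Y Z X q qy b qz ->
  (forall w, cnt rx w + cnt qz w <= 1) ->
  [/\ size b + size qz <= size ry, size c + size rx <= size qy &
    exists2 v, v \in ry & v \in qy].
Proof.
move=> tr [_ hy _] tr' tq dj; have part := tr_part tr.
have cr := class_cnt tr'; have cq := class_cnt tq.
case: tr' => [lr zr [wrx wc wry szr crr yc cX] sa sb].
case: tq => [lq xq [wqy wb wqz szq cqq zb bY] sa' sb'].
have rxS : forall w, cnt rx w <= (w \in X) + (w \in Z) by case: sa => S; clear - S; cnts.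
have ryS : forall w, cnt ry w <= (w \in X) + (w \in Y) by case: sb => S; clear - S; cnts.
have qyS : forall w, cnt qy w <= (w \in X) + (w \in Y) by case: sa' => S; clear - S; cnts.
have qzS : forall w, cnt qz w <= (w \in Y) + (w \in Z) by case: sb' => S; clear - S; cnts.
clear sa sb sa' sb' crr cqq.
have [tx [wtx stx ctx]] := walk_rev e_sym wrx.
have [ty [wty sty cty]] := walk_rev e_sym wqy.
bound ce (walk_cat wtx (walk_cat wc (walk_cat wb wqz))) as b1.
have [l1 l2] : size b + size qz <= size ry /\ size c + size rx <= size qy by split; blia.
split=> //.
have ury : uniq ry by apply/cnt_uniq; clear - cr; cnts.
have uqy : uniq qy by apply/cnt_uniq; clear - cq; cnts.
have [dj'|//] := cnt_disj ury uqy.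
have wl := walk_cat wty wry.
have ul : forall w, (last y qy == w) + cnt (ty ++ ry) w <= 1.
  by clear - cty dj' cr cq yc; cnts.
have c0 : 0 < size c by case: (c) yc => //= /(_ y); rewrite eqxx.
have bl := walk_bound ce wl ul; rewrite size_cat sty in bl.
case: (hy (last y qy :: ty ++ ry)).
- by apply: (walk_longest wl ul); rewrite size_cat; blia.
- by apply: notin_cnt; clear - cty dj' cr cq yc zb qyS ryS part; cnts.
- by apply: notin_cnt; clear - cty dj' cr cq yc zb qyS ryS part; cnts.
Qed.

Lemma class_not_inside x y z X Y Z p a m b : triangle x y z X Y Z ->
  two_class x y z X Y Z p a m b ->
  (forall w, cnt a w <= (w \in X)) -> (forall w, cnt b w <= (w \in X)) -> False.
Proof.
move=> [part _ _ _ capX _ _] [lp zp [_ _ _ _ cp _ mX] _ _] aX bX.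
have [v vp vX] := all_captures capX lp.
by have := cp v; have := mX v; have := aX v; have := bX v; blia.
Qed.

(** Suppose that [r] and [q] do not meet in [Z]. By [exchange], their tails at [y]
    meet, so both lie in [X] or both in [Y]. Then [p] does not meet one of them on
    the side opposite to their common vertex, and [exchange], applied again,
    shows that it does not meet the other one either. The inequalities obtained
    in this way, around the triangle, are circular. *)
Lemma classes_meet x y z X Y Z r rx c ry q qy b qz p pz a px :
  triangle x y z X Y Z -> no_single x y z ->
  two_class x y z X Y Z r rx c ry -> two_class y z x Y Z X q qy b qz ->
  two_class z x y Z X Y p pz a px ->
  exists2 v, v \in rx & v \in qz.
Proof.
move=> tr ns cr cq cp; have part := tr_part tr.
have urx : uniq rx by have h := class_cnt cr; apply/cnt_uniq; clear - h; cnts.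
have uqz : uniq qz by have h := class_cnt cq; apply/cnt_uniq; clear - h; cnts.
have [dj|//] := cnt_disj urx uqz; exfalso.
have [l1 l2 [v vry vqy]] := exchange tr ns cr cq dj.
have tr1 := triangle_rot tr; have tr2 := triangle_rot tr1.
have ns1 := no_single_rot ns; have ns2 := no_single_rot ns1.
have a_gt0 := through_gt0 (tc_through cp).
rewrite !mem_cnt in vry vqy.
case: (tc_b cr) => ryS; case: (tc_a cq) => qyS.
- by have := part v; have := ryS v; have := qyS v; blia.
- case: (tc_a cr) => rxS; first exact: class_not_inside tr cr rxS ryS.
  have [|l3 l4 [u upx urx']] := exchange tr2 ns2 cp cr.
    by case: (tc_a cp) => pzS; clear - pzS ryS part; cnts.
  rewrite !mem_cnt in upx urx'.
  case: (tc_b cp) => pxS; last by have := part u; have := rxS u; have := pxS u; blia.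
  have [|l5 l6 _] := exchange tr1 ns1 cq cp; first by clear - pxS qyS part; cnts.
  by blia.
- case: (tc_b cq) => qzS; first exact: class_not_inside tr1 cq qyS qzS.
  have [|l5 l6 [u uqz' upz]] := exchange tr1 ns1 cq cp.
    by case: (tc_b cp) => pxS; clear - pxS qyS part; cnts.
  rewrite !mem_cnt in uqz' upz.
  case: (tc_a cp) => pzS; last by have := part u; have := qzS u; have := pzS u; blia.
  have [|l3 l4 _] := exchange tr2 ns2 cp cr; first by clear - pzS ryS part; cnts.
  by blia.
- by have := part v; have := ryS v; have := qyS v; blia.
Qed.

End TwoClasses.

Section Spread.

Variables (T : finType) (e : rel T) (L : nat).
Hypothesis ce : counterexample e L.
Variables (x y z : T) (X Y Z : {set T}).
Hypothesis tr : triangle e L x y z X Y Z.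
Hypothesis ns : no_single e L x y z.
Implicit Types (u v w s t : T) (p q r a b m : seq T) (D : {set T}).

Let longest := longest e L.
Let walk := walk e.
Let e_sym := ce_sym ce.

Let tr1 := triangle_rot tr.
Let tr2 := triangle_rot tr1.
Let ns1 := no_single_rot ns.
Let ns2 := no_single_rot ns1.

Lemma class_xy : exists r rx c ry, two_class e L x y z X Y Z r rx c ry.
Proof. by have [r lr zr] := ce_avoid ce z; exists r; apply: two_classP. Qed.

Lemma class_yz : exists q qy b qz, two_class e L y z x Y Z X q qy b qz.
Proof. by have [q lq xq] := ce_avoid ce x; exists q; apply: two_classP. Qed.

Lemma class_zx : exists p pz a px, two_class e L z x y Z X Y p pz a px.
Proof. by have [p lp yp] := ce_avoid ce y; exists p; apply: two_classP. Qed.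

(** Any two of the paths that meet the triangle in exactly two vertices meet
    on the side opposite to their common vertex, so the middle part and the two
    tails of each path lie on three different sides. *)
Lemma spread_tails r rx c ry q qy b qz :
  two_class e L x y z X Y Z r rx c ry -> two_class e L y z x Y Z X q qy b qz ->
  [/\ forall w, cnt rx w <= (w \in Z), forall w, cnt qz w <= (w \in Z),
    forall w, cnt qy w <= (w \in X), forall w, cnt ry w <= (w \in Y) &
    exists2 v, v \in rx & v \in qz].
Proof.
move=> cr cq; have [p [pz [a [px cp]]]] := class_zx; have part := tr_part tr.
have [u urx uqz] := classes_meet ce tr ns cr cq cp.
have [v vqy vpx] := classes_meet ce tr1 ns1 cq cp cr.
have [t tpz try] := classes_meet ce tr2 ns2 cp cr cq.
split; last by exists u.
- case: (tc_a cr) => // rX; case: (tc_b cq) => qS;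
    have := part u; have := rX u; have := qS u; move: urx uqz; rewrite !mem_cnt; blia.
- case: (tc_b cq) => // qS; case: (tc_a cr) => rX;
    have := part u; have := rX u; have := qS u; move: urx uqz; rewrite !mem_cnt; blia.
- case: (tc_a cq) => // qS; case: (tc_b cp) => pS;
    have := part v; have := pS v; have := qS v; move: vqy vpx; rewrite !mem_cnt; blia.
- case: (tc_b cr) => // rS; case: (tc_a cp) => pS;
    have := part t; have := pS t; have := rS t; move: tpz try; rewrite !mem_cnt; blia.
Qed.

Variables (r0 rx0 c0 ry0 : seq T).
Hypothesis cr0 : two_class e L x y z X Y Z r0 rx0 c0 ry0.

Let D := component e x z (head x rx0).

Lemma spread_component : [/\ attached e x z D,
  forall w, (w \in D) <= (w \in Z), forall w, cnt rx0 w <= (w \in D) & head x rx0 \in Z].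
Proof.
have [q [qy [b [qz cq]]]] := class_yz.
have [rZ _ _ _ [v vr _]] := spread_tails cr0 cq.
by apply: (tail_component ce tr (th_a (tc_through cr0)) _ rZ); case: (rx0) vr.
Qed.

Lemma spread_inner r rx c ry q qy b qz :
  two_class e L x y z X Y Z r rx c ry -> two_class e L y z x Y Z X q qy b qz ->
  (forall w, cnt rx w <= (w \in D)) /\ (forall w, cnt qz w <= (w \in D)).
Proof.
have [aD DZ rD _] := spread_component; have part := tr_part tr.
have qD q' qy' b' qz' : two_class e L y z x Y Z X q' qy' b' qz' ->
    forall w, cnt qz' w <= (w \in D).
  move=> cq'; have [_ qZ _ _ [v vr vq]] := spread_tails cr0 cq'.
  case: (attached_walk e_sym aD (th_b (tc_through cq'))) => [|//|out].
    by clear - qZ part; cnts.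
  by have := out v; have := rD v; move: vr vq; rewrite !mem_cnt; blia.
move=> cr cq; split; last exact: qD cq.
have [rZ _ _ _ [v vr vq]] := spread_tails cr cq; have qD' := qD _ _ _ _ cq.
case: (attached_walk e_sym aD (th_a (tc_through cr))) => [|//|out].
  by clear - rZ part; cnts.
by have := out v; have := qD' v; move: vr vq; rewrite !mem_cnt; blia.
Qed.

Lemma spread_meet r q : longest r -> longest q -> z \notin r -> x \notin q -> meet_in D r q.
Proof.
move=> lr lq zr xq.
have [rx [c [ry cr]]] := two_classP ce tr ns lr zr.
have [qy [b [qz cq]]] := two_classP ce tr1 ns1 lq xq.
have [rD qD] := spread_inner cr cq; have [_ _ _ _ [v vr vq]] := spread_tails cr cq.
exists v; split; last exact: cnt_sub rD vr.
- by move: vr; rewrite !mem_cnt (th_cnt (tc_through cr)); blia.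
- by move: vq; rewrite !mem_cnt (th_cnt (tc_through cq)); blia.
Qed.

Lemma spread_crossing r rx c ry q qy b qz :
  two_class e L x y z X Y Z r rx c ry -> two_class e L y z x Y Z X q qy b qz ->
  exists n, [/\ walk z n y, size n = size b,
    forall w, cnt n w + (z == w) = (y == w) + cnt b w &
    crossing e L x z D (c ++ ry) rx (n ++ qy) qz].
Proof.
move=> cr cq; have [aD DZ rD0 _] := spread_component; have part := tr_part tr.
have [rxZ qzZ qyX ryY [v vr vq]] := spread_tails cr cq.
have [rD qD] := spread_inner cr cq.
have ur := class_cnt cr; have uq := class_cnt cq.
case: cr => [lr zr [wrx wc wry szr crr yc cX] _ _].
case: cq => [lq xq [wqy wb wqz szq cqq zb bY] _ _].
have [n [wn sn cn]] := walk_rev e_sym wb.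
exists n; split=> //; split=> //.
- by have := walk_cat wc wry; rewrite last_cat; case: (wc) => _ ->.
- by rewrite size_cat; lia.
- by clear - ur; cnts.
- by have := walk_cat wn wqy; rewrite last_cat; case: (wn) => _ ->.
- by rewrite size_cat; lia.
- by clear - uq cn; cnts.
- by clear - part DZ; cnts.
- by clear - cX ryY part DZ; cnts.
- by clear - cn bY qyX part DZ; cnts.
- by exists v.
Qed.

(** A longest path avoiding [D] passes through [x] and [z] by [spread_meet].
    Unless [y] is between them and the tails lie in [X] and [Y], it is excluded by
    [no_bypass] or [no_detour]. In the remaining case, its two halves at [y] can
    be exchanged against parts of [r] and [q], which makes the tails of [r] and
    [q] at [y] so long that they form a longest path with only [y] on the
    triangle. *)
Lemma spread_all p : longest p -> exists2 v, v \in p & v \in D.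
Proof.
move=> lp; apply: NNPP => no; have part := tr_part tr.
have [aD DZ rD0 _] := spread_component; have c1 := longest_cnt lp.
have pD w : cnt p w + (w \in D) <= 1.
  have := c1 w; have [wD|_] := boolP (w \in D); last by blia.
  have [wp|] := boolP (w \in p); first by case: no; exists w.
  by rewrite mem_cnt; blia.
have [q lq xq] := ce_avoid ce x; have [r lr zr] := ce_avoid ce z.
have zp : z \in p.
  apply/negPn/negP => zp; have [v [vp _ vD]] := spread_meet lp lq zp xq.
  by case: no; exists v.
have xp : x \in p.
  apply/negPn/negP => xp; have [v [_ vp vD]] := spread_meet lr lp zr xp.
  by case: no; exists v.
have [rx [c [ry cr]]] := two_classP ce tr ns lr zr.
have [qy [b [qz cq]]] := two_classP ce tr1 ns1 lq xq.
have [n [wn sn cn cro]] := spread_crossing cr cq.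
have [rxZ qzZ qyX ryY _] := spread_tails cr cq; have [rD qD] := spread_inner cr cq.
have ur := class_cnt cr; have uq := class_cnt cq.
have [wrx wc wry szr crr yc cX] := tc_through cr.
have [wqy wb wqz szq cqq zb bY] := tc_through cq.
have xz : x != z by rewrite eq_sym; apply: triangle_neq tr2.
have [a' [s [g [b' [t [wa' wg wb' sz' [cp gz]]]]]]] := longest_at2 e_sym lp xp zp xz.
have wa'' : walk x a' (last x a') by case: wa'.
have wb'' : walk z b' (last z b') by case: wb'.
have [yg|yg] := boolP (y \in g); last first.
  have yg' : forall w, cnt g w + (x == w) + (y == w) <= 1.
    have ug : uniq g by apply/cnt_uniq; clear - c1 cp; cnts.
    have cyg := cnt_notin ug yg; have nxy := neq_cnt (triangle_neq tr).
    by clear - nxy cyg cp c1; cnts.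
  have gZ := mid_side ce (triangle_swap tr2) wg yg'.
  apply: (no_bypass ce cro wa'' wg wb'' _ _ gz) => //.
  - by clear - cp c1 pD; cnts.
  - by clear - gZ cX ryY ur part; cnts.
have ygx : y \in x :: g by rewrite inE yg orbT.
have [g1 [g2 [E wg1 wg2 yg1]]] := walk_split wg ygx.
have {}yg1 : forall w, (y == w) <= cnt g1 w by move=> w; apply: yg1.
have zg2 := walk_end wg2 (triangle_neq tr1).
have cg w : cnt g w = cnt g1 w + cnt g2 w by rewrite E cnt_cat.
have aS : (forall w, cnt a' w <= (w \in X)) \/ (forall w, cnt a' w <= (w \in Z)).
  by apply: (tail_sides ce tr wa'); clear - cp c1 cg yg1 zg2 part; cnts.
have bS : (forall w, cnt b' w <= (w \in Z)) \/ (forall w, cnt b' w <= (w \in Y)).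
  by apply: (tail_sides ce tr2 wb'); clear - cp c1 cg yg1 zg2 part; cnts.
have g1X : forall w, cnt g1 w <= (w \in X) + (y == w).
  by apply: (mid_side ce tr wg1); clear - cp c1 cg yg1 zg2 part; cnts.
have g2Y : forall w, cnt g2 w <= (w \in Y) + (z == w).
  by apply: (mid_side ce tr1 wg2); clear - cp c1 cg yg1 zg2 part; cnts.
case: bS => [bZ|bY'].
  have [n' [wn' sn' cn']] := walk_rev e_sym wg.
  apply: (no_detour ce cro (a := n' ++ a') (b := b')) => //.
  - by have := walk_cat wn' wa''; rewrite last_cat; case: (wn') => _ ->.
  - by rewrite size_cat; blia.
  - by clear - cp c1 pD cn'; cnts.
  - by clear - bZ cX ryY ur part; cnts.
case: aS => [aX|aZ]; last first.
  apply: (no_detour ce (crossing_sym cro) (a := g ++ b') (b := a')) => //.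
  - by have := walk_cat wg wb''; rewrite last_cat; case: (wg) => _ ->.
  - by rewrite size_cat; blia.
  - by clear - cp c1 pD; cnts.
  - by clear - aZ cn bY qyX uq part; cnts.
have [tx [wtx stx ctx]] := walk_rev e_sym wrx.
have [ta [wta sta cta]] := walk_rev e_sym wa'.
have [ty [wty sty cty]] := walk_rev e_sym wqy.
have up : forall w, (x == w) + cnt a' w + cnt g1 w + cnt g2 w + cnt b' w <= 1.
  by clear - cp c1 cg; cnts.
bound ce (walk_cat wtx (walk_cat wc (walk_cat wg2 wb'))) as b1
  by (clear - ctx ur up rD DZ cX yc g2Y zg2 bY' yg1 part).
bound ce (walk_cat wta (walk_cat wg1 (walk_cat wb wqz))) as b2
  by (clear - cta uq up qD DZ bY zb g1X zg2 aX yg1 part).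
have wl := walk_cat wty wry.
have ul : forall w, (last y qy == w) + cnt (ty ++ ry) w <= 1.
  by clear - cty ryY qyX ur uq yc part; cnts.
have bl := walk_bound ce wl ul; rewrite size_cat sty in bl.
have [_ hy _] := ns; case: (hy (last y qy :: ty ++ ry)).
- by apply: (walk_longest wl ul); move: sz'; rewrite E !size_cat; blia.
- by apply: notin_cnt; clear - cty ryY qyX ur uq yc part; cnts.
- by apply: notin_cnt; clear - cty ryY qyX ur uq yc part; cnts.
Qed.

End Spread.

Lemma no_single_captures (T : finType) (e : rel T) (L : nat) (x y z : T) (X Y Z : {set T}) :
  counterexample e L -> triangle e L x y z X Y Z -> no_single e L x y z ->
  exists2 u, u \in Z & captures e L x z (component e x z u).
Proof.
move=> ce tr ns; have [r [rx [c [ry cr]]]] := class_xy ce tr ns.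
exists (head x rx); first by case: (spread_component ce tr ns cr).
split.
- by move=> p q lp lq zp xq; apply: (spread_meet ce tr ns cr).
- by move=> p lp; apply: (spread_all ce tr ns cr).
Qed.

(** * Series-parallel pieces *)

Lemma triangle_captures (T : finType) (e : rel T) (L : nat) (x y z : T) (X Y Z : {set T}) :
  counterexample e L -> triangle e L x y z X Y Z ->
  (exists2 u, u \in Z & captures e L x z (component e x z u)) \/
  (exists2 u, u \in Y & captures e L y z (component e y z u)).
Proof.
move=> ce tr.
have [[p [lp yp zp]]|hx] := classic (exists p, [/\ longest e L p, y \notin p & z \notin p]).
  by left; apply: (single_captures ce tr lp yp zp).
have [[p [lp zp xp]]|hy] := classic (exists p, [/\ longest e L p, z \notin p & x \notin p]).
  by right; apply: (single_captures ce (triangle_swap tr) lp xp zp).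
have [[p [lp xp yp]]|hz] := classic (exists p, [/\ longest e L p, x \notin p & y \notin p]).
  right; have [u uY cap] := single_captures ce (triangle_rot (triangle_rot tr)) lp xp yp.
  by exists u => //; rewrite component_sym; apply: captures_sym.
left; apply: no_single_captures ce tr _; split=> p *.
- by apply: hx; exists p.
- by apply: hy; exists p.
- by apply: hz; exists p.
Qed.

(** The decomposition of a graph with terminals [x] and [y] into series and
    parallel compositions; the set consists of the vertices other than the
    terminals. An edge between the terminals is allowed everywhere, so that the
    relation is about the absence of edges only. *)
Inductive piece (T : finType) (k : rel T) : T -> T -> {set T} -> Prop :=
| piece_edge x y : x != y -> piece k x y set0
| piece_parallel x y A B : piece k x y A -> piece k x y B -> [disjoint A & B] ->
    (forall u v, u \in A -> v \in B -> ~~ k u v) -> piece k x y (A :|: B)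
| piece_series x y z A B : piece k x z A -> piece k y z B -> x != y ->
    x \notin B -> y \notin A -> [disjoint A & B] ->
    (forall u v, u \in A -> v \in y |: B -> ~~ k u v) ->
    (forall v, v \in B -> ~~ k v x) -> piece k x y (z |: (A :|: B)).

Section Pieces.

Variables (T : finType).
Implicit Types (k e : rel T) (x y z u v w : T) (A B C D : {set T}).

Lemma piece_ends k x y C : piece k x y C -> [/\ x != y, x \notin C & y \notin C].
Proof.
elim=> {x y C} [x y xy|x y A B _ [xy xA yA] _ [_ xB yB] _ _|
    x y z A B _ [xz xA zA] _ [yz yB zB] xy xB yA _ _ _].
- by rewrite !inE.
- by rewrite !inE !negb_or xA yA.
- by rewrite !inE !negb_or xz yz xA xB yA yB.
Qed.

Lemma captures_sub e L x y C D : {subset C <= D} -> captures e L x y C -> captures e L x y D.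
Proof.
move=> sCD [cp ca]; split.
- by move=> p q lp lq yp xq; have [v [vp vq /sCD vD]] := cp p q lp lq yp xq; exists v.
- by move=> p lp; have [v vp /sCD vD] := ca p lp; exists v.
Qed.

Lemma component_meets e L x y A u v : counterexample e L ->
  attached e x y A -> v \in component e x y u -> v \in A -> u \in A.
Proof.
move=> ce aA vu vA; have [E|dis] := component_disjoint (ce_sym ce) x y u v.
  by apply: (component_min aA vA); rewrite -E mem_component.
by have := dis v; rewrite vu mem_component.
Qed.

(** By induction on the piece. In a parallel composition, the component lies in
    one of the two parts. In a series composition with apex [z], the induction
    hypotheses say that the components that capture for [x], [z] and for [y], [z]
    are outside the two parts, so [x], [y] and [z] form a triangle to which
    [triangle_captures] applies; but its conclusion contradicts the induction
    hypotheses. *)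
Lemma piece_captures_not e L k x y C : counterexample e L -> subrel e k -> piece k x y C ->
  attached e x y C ->
  forall u, u \in C -> captures e L x y (component e x y u) -> False.
Proof.
move=> ce ek; have e_sym := ce_sym ce.
elim=> {x y C} [x y xy|x y A B pA IHA pB IHB _ nAB|x y z A B pA IHA pB IHB xy xB yA dAB nA nB] aC u.
- by rewrite inE.
- have aA : attached e x y A.
    move=> v w vA evw; have := aC v w; rewrite !inE vA => /(_ isT evw).
    case wB: (w \in B); rewrite ?orbF //.
    by have := nAB v w vA wB; rewrite ek.
  have aB : attached e x y B.
    move=> v w vB evw; have := aC v w; rewrite !inE vB orbT => /(_ isT evw).
    case wA: (w \in A); rewrite ?orFb //.
    by have := nAB w v wA vB; rewrite ek // e_sym.
  by rewrite inE => /orP[uA|uB]; [apply: IHA uA | apply: IHB uB].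
- have [xz xA zA] := piece_ends pA; have [yz yB zB] := piece_ends pB.
  have aA : attached e x z A.
    move=> v w vA evw; have := aC v w; rewrite !inE vA orbT => /(_ isT evw).
    have : w \notin y |: B by apply/negP => /(nA v w vA); rewrite ek.
    rewrite !inE negb_or => /andP[/negPf-> /negPf->]; rewrite !orbF.
    by case: (w == z); case: (w \in A); case: (w == x).
  have aB : attached e y z B.
    move=> v w vB evw; have := aC v w; rewrite !inE vB !orbT => /(_ isT evw).
    have wA : w \notin A.
      have vyB : v \in y |: B by rewrite !inE vB orbT.
      by apply/negP => wA; have := nA w v wA vyB; rewrite ek // e_sym.
    have : w != x by apply/eqP => wx; have := nB v vB; rewrite -wx ek.
    by rewrite (negPf wA) => /negPf->; case: (w == z); case: (w \in B); case: (w == y).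
  move=> uC cap; set X := ~: ([set x; y] :|: (z |: (A :|: B))).
  suff tr : triangle e L x y z X B A.
    have [[v vA cv]|[v vB cv]] := triangle_captures ce tr.
    + exact: IHA aA v vA cv.
    + exact: IHB aB v vB cv.
  have inX v : (v \in X) = ~~ [|| v == x, v == y, v == z, v \in A | v \in B].
    by rewrite !inE !orbA.
  have xyC : [/\ x \notin z |: (A :|: B) & y \notin z |: (A :|: B)].
    by rewrite !inE !negb_or xz yz xA xB yA yB.
  have uxy : u \notin [:: x; y].
    by rewrite !inE; apply/norP; split; apply: contraTneq uC => ->; case: xyC.
  split.
  + move=> w; rewrite inX ![w == _]eq_sym.
    have : ~~ ((w \in A) && (w \in B)).
      by apply/negP => /andP[wA]; apply/negP; rewrite (disjointFr dAB wA).
    case: (eqVneq x w) => [<-|_].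
      by rewrite (negPf xA) (negPf xB) ![_ == x]eq_sym (negPf xy) (negPf xz).
    case: (eqVneq y w) => [<-|_].
      by rewrite (negPf yA) (negPf yB) ![_ == y]eq_sym (negPf yz).
    case: (eqVneq z w) => [<-|_]; first by rewrite (negPf zA) (negPf zB).
    by case: (w \in A); case: (w \in B).
  + move=> v w vX evw; rewrite inX.
    have [->|wx] := eqVneq w x; first by rewrite orbT.
    have [->|wy] := eqVneq w y; first by rewrite !orbT.
    rewrite !orbF /=; apply/negP => wC.
    have wC' : w \in z |: (A :|: B) by rewrite !inE.
    have := aC w v wC'; rewrite e_sym => /(_ evw).
    by move: vX; rewrite inX !inE; case: (v == x); case: (v == y); case: (v == z);
      case: (v \in A); case: (v \in B).
  + exact: aB.
  + exact: attached_sym.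
  + apply: captures_sub cap => w wu; rewrite !inE.
    have := component_avoid e xy uxy w; rewrite wu ![_ == w]eq_sym.
    have := component_min aC uC wu; rewrite !inE.
    by case: (w == x); case: (w == y); case: (w == z); case: (w \in A); case: (w \in B).
  + have [v vyz cv] := component_captures ce yz.
    have vB : v \notin B by apply/negP => vB; apply: IHB aB v vB cv.
    apply: captures_sub cv => w wv; rewrite !inE.
    have := component_avoid e yz vyz w; rewrite wv ![_ == w]eq_sym.
    have wB : w \notin B by apply: contra vB; apply: component_meets ce aB wv.
    by rewrite (negPf wB); case: (w == y); case: (w == z).
  + have [v vxz cv] := component_captures ce xz.
    have vA : v \notin A by apply/negP => vA; apply: IHA aA v vA cv.
    apply: captures_sub (captures_sym cv) => w wv; rewrite !inE.
    have := component_avoid e xz vxz w; rewrite wv ![_ == w]eq_sym.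
    have wA : w \notin A by apply: contra vA; apply: component_meets ce aA wv.
    by rewrite (negPf wA); case: (w == x); case: (w == z).
Qed.

Lemma piece_no_counterexample e L k x y : counterexample e L -> subrel e k ->
  piece k x y (~: [set x; y]) -> False.
Proof.
move=> ce ek pxy; have [xy _ _] := piece_ends pxy.
have [u uxy cu] := component_captures ce xy.
apply: (piece_captures_not ce ek pxy _ _ cu); last by rewrite !inE in uxy *.
by move=> v w _ _; rewrite !inE; case: (w == x); case: (w == y).
Qed.

End Pieces.

(** * Pieces of a 2-tree *)

Section TwoTrees.

Lemma piece_map (T U : finType) (f : T -> U) (k : rel T) (l : rel U) x y C :
  injective f -> (forall u v, l (f u) (f v) = k u v) ->
  piece k x y C -> piece l (f x) (f y) (f @: C).
Proof.
move=> fI fk; elim=> {x y C} [x y xy|x y A B _ IHA _ IHB dAB nAB|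
    x y z A B _ IHA _ IHB xy xB yA dAB nA nB].
- by rewrite imset0; apply: piece_edge; rewrite (inj_eq fI).
- rewrite imsetU; apply: piece_parallel => //; first by rewrite imset_disjoint //; apply: in2W.
  by move=> _ _ /imsetP[u uA ->] /imsetP[v vB ->]; rewrite fk nAB.
- rewrite imsetU1 imsetU; apply: piece_series => //.
  + by rewrite (inj_eq fI).
  + by rewrite mem_imset.
  + by rewrite mem_imset.
  + by rewrite imset_disjoint //; apply: in2W.
  + by rewrite -imsetU1 => _ _ /imsetP[u uA ->] /imsetP[v vB ->]; rewrite fk nA.
  + by move=> _ /imsetP[v vB ->]; rewrite fk nB.
Qed.

Variables (T : finType) (k : rel T).
Hypothesis k_sym : symmetric k.
Implicit Types (x y z u v w a b : T) (A B C : {set T}).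

Lemma disjoint_add v A B : v \notin B -> [disjoint A & B] -> [disjoint v |: A & B].
Proof. by move=> vB; rewrite !disjoints_subset subUset sub1set inE vB. Qed.

(** Two edges in series through [v] are put in parallel with the piece. *)
Lemma piece_ear x y C v : piece k x y C -> v \notin C -> v != x -> v != y ->
  (forall w, k v w -> (w == x) || (w == y)) -> piece k x y (v |: C).
Proof.
move=> pC vC vx vy kv; have [xy xC yC] := piece_ends pC.
have pv : piece k x y (v |: (set0 :|: set0)).
  apply: piece_series; rewrite ?inE //; try by apply: piece_edge; rewrite eq_sym.
  + by rewrite -setI_eq0 setI0.
  + by move=> u w; rewrite inE.
  + by move=> w; rewrite inE.
rewrite !setU0 in pv; rewrite setUC; apply: piece_parallel => //.
- by rewrite disjoint_sym disjoints1.
- move=> u w uC; rewrite !inE => /eqP->; rewrite k_sym; apply/negP => /kv.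
  by case/orP => /eqP ue; rewrite ue ?(negPf xC) ?(negPf yC) in uC.
Qed.

(** A new vertex [v] of degree two, whose neighbours [a] and [b] are adjacent: as
    they are adjacent, both are in the same part of every composition, up to its
    terminals, until they are the terminals themselves. *)
Lemma piece_insert a b v x y C : k a b -> (forall w, k v w -> (w == a) || (w == b)) ->
  piece k x y C -> v \notin C -> v != x -> v != y ->
  [|| a \in C, a == x | a == y] -> [|| b \in C, b == x | b == y] ->
  piece k x y (v |: C).
Proof.
move=> kab kv pC; have kba : k b a by rewrite k_sym.
have ear x' y' C' : piece k x' y' C' -> v \notin C' -> v != x' -> v != y' ->
    (a == x') || (a == y') -> (b == x') || (b == y') -> piece k x' y' (v |: C').
  move=> pC' vC vx vy axy bxy; apply: piece_ear => // w /kv.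
  by case/orP => /eqP->.
elim: pC => {x y C} [x y xy|x y A B pA IHA pB IHB dAB nAB|
    x y z A B pA IHA pB IHB xy xB yA dAB nA nB] vC vx vy aC bC.
- by apply: ear; rewrite ?inE in aC bC *; rewrite // ?inE; apply: piece_edge.
- have [_ xA yA] := piece_ends pA; have [_ xB yB] := piece_ends pB.
  move: vC; rewrite inE negb_or => /andP[vA vB].
  have n1 : ~~ ((a \in A) && (b \in B)) by apply/negP => /andP[h /(nAB _ _ h)]; rewrite kab.
  have n2 : ~~ ((b \in A) && (a \in B)) by apply/negP => /andP[h /(nAB _ _ h)]; rewrite kba.
  have [/andP[aA bA]|noA] := boolP ([|| a \in A, a == x | a == y] && [|| b \in A, b == x | b == y]).
    rewrite setUA; apply: piece_parallel => //; first exact: IHA.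
    + exact: disjoint_add.
    + move=> u w; rewrite !inE => /orP[/eqP->|uA] wB; last exact: nAB.
      apply/negP => /kv/orP[]/eqP wE; rewrite wE in wB.
        by move: aA; rewrite (disjointFl dAB wB) /=; 
          case/orP => /eqP aE; move: wB; rewrite aE ?(negPf xB) ?(negPf yB).
      by move: bA; rewrite (disjointFl dAB wB) /=; 
          case/orP => /eqP aE; move: wB; rewrite aE ?(negPf xB) ?(negPf yB).
  have [/andP[aB bB]|noB] := boolP ([|| a \in B, a == x | a == y] && [|| b \in B, b == x | b == y]).
    rewrite setUCA; apply: piece_parallel => //; first exact: IHB.
    + by rewrite disjoint_sym disjoint_add // disjoint_sym.
    + move=> u w uA; rewrite !inE => /orP[/eqP->|wB]; last exact: nAB.
      rewrite k_sym; apply/negP => /kv/orP[]/eqP uE; rewrite uE in uA.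
        by move: aB; rewrite (disjointFr dAB uA) /=; 
          case/orP => /eqP aE; move: uA; rewrite aE ?(negPf xA) ?(negPf yA).
      by move: bB; rewrite (disjointFr dAB uA) /=; 
          case/orP => /eqP aE; move: uA; rewrite aE ?(negPf xA) ?(negPf yA).
  move: aC bC noA noB n1 n2; rewrite !inE.
  by case: (a \in A); case: (a \in B); case: (b \in A); case: (b \in B);
     case: (_ || _); case: (_ || _).
- have [xz xA zA] := piece_ends pA; have [yz yB zB] := piece_ends pB.
  move: vC; rewrite !inE !negb_or => /and3P[vz vA vB].
  have n1 u w : k u w -> ~~ ((u \in A) && ((w == y) || (w \in B))).
    by move=> kuw; apply/negP => /andP[uA wB]; have := nA u w uA; rewrite !inE wB kuw => /(_ isT).
  have n2 u w : k u w -> ~~ ((u \in B) && (w == x)).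
    by move=> kuw; apply/negP => /andP[/nB nux /eqP wx]; rewrite -wx kuw in nux.
  have [/andP[aA bA]|noA] := boolP ([|| a \in A, a == x | a == z] && [|| b \in A, b == x | b == z]).
    rewrite setUCA [v |: (A :|: B)]setUA; apply: piece_series => //; first exact: IHA.
    + by rewrite !inE negb_or eq_sym vy.
    + exact: disjoint_add.
    + move=> u w; rewrite !inE => /orP[/eqP->|uA] wB; last by apply: nA; rewrite ?inE.
      have wA : ~~ [|| w \in A, w == x | w == z].
        case/orP: wB => [/eqP->|wB]; first by rewrite (negPf yA) eq_sym (negPf xy) (negPf yz).
        rewrite (disjointFl dAB wB) /=; apply/norP; split; apply: contraTneq wB => -> //.
      by apply/negP => /kv/orP[]/eqP wE; rewrite wE ?aA ?bA in wA.
  have [/andP[aB bB]|noB] := boolP ([|| a \in B, a == y | a == z] && [|| b \in B, b == y | b == z]).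
    rewrite setUCA [v |: (A :|: B)]setUCA; apply: piece_series => //; first exact: IHB.
    + by rewrite !inE negb_or eq_sym vx.
    + by rewrite disjoint_sym disjoint_add // disjoint_sym.
    + move=> u w uA; rewrite !inE orbCA => /orP[/eqP->|wB]; last by apply: nA; rewrite ?inE.
      have uB : ~~ [|| u \in B, u == y | u == z].
        rewrite (disjointFr dAB uA) /=; apply/norP; split; apply: contraTneq uA => -> //.
      by rewrite k_sym; apply/negP => /kv/orP[]/eqP uE; rewrite uE ?aB ?bB in uB.
    + move=> w; rewrite !inE => /orP[/eqP->|]; last exact: nB.
      have xB' : ~~ [|| x \in B, x == y | x == z] by rewrite (negPf xB) (negPf xy) (negPf xz).
      by apply/negP => /kv/orP[]/eqP xE; rewrite -xE in aB bB; rewrite ?aB ?bB in xB'.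
  have := n1 _ _ kab; have := n1 _ _ kba; have := n2 _ _ kab; have := n2 _ _ kba.
  have [/andP[axy bxy] *|] := boolP (((a == x) || (a == y)) && ((b == x) || (b == y))).
    by apply: ear => //; rewrite ?inE ?negb_or ?vz ?vA //; apply: piece_series.
  move: aC bC noA noB; rewrite !inE.
  case: (a \in A) => /=.
    by case: (b \in A); case: (b \in B); case: (b == x);
      case: (b == y); case: (b == z).
  case: (a \in B) => /=.
    by case: (b \in A); case: (b \in B); case: (b == x); case: (b == y);
      case: (b == z); rewrite ?andbT ?orbT.
  case: (a == z) => /=.
    by case: (b \in A); case: (b \in B); case: (b == x); case: (b == y);
      case: (b == z); rewrite ?andbT ?orbT.
  by case: (a == x); case: (a == y); case: (b \in A); case: (b \in B); case: (b == x);
      case: (b == y); case: (b == z).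
Qed.

End TwoTrees.

Lemma two_tree_piece (H : sgraph) : two_tree H ->
  exists x y : H, piece (@adj H) x y (~: [set x; y]).
Proof.
elim=> {H} [H [H2 _]|H v dv nv _ [x [y pxy]]].
  have /cards2P[x [y [xy E]]] : #|[set: H]| == 2 by rewrite cardsT H2.
  by exists x, y; rewrite -E setCT; apply: piece_edge.
have /cards2P[a [b [ab E]]] : #|neighbors v| == 2 by rewrite -[#|_|]/(degree v) dv.
have va : a \in neighbors v by rewrite E !inE eqxx.
have vb : b \in neighbors v by rewrite E !inE eqxx orbT.
have kab : adj a b by apply: nv.
have adj_neq u : u \in neighbors v -> u != v.
  by rewrite inE; apply: contraTneq => ->; rewrite adj_irrefl.
exists (val x), (val y).
have := piece_map (l := @adj H) val_inj (fun _ _ => erefl) pxy.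
set C := val @: _ => pC.
have inC u : (u \in C) = [&& u != v, u != val x & u != val y].
  apply/imsetP/and3P => [[w]|[uv ux uy]].
    rewrite !inE negb_or => /andP[wx wy] ->; rewrite !val_eqE wx wy.
    by split=> //; apply: (valP w).
  by exists (Sub u uv); rewrite // !inE negb_or -!val_eqE /= ux uy.
have -> : ~: [set val x; val y] = v |: C.
  apply/setP => u; rewrite !inE inC negb_or; case: (eqVneq u v) => [->|] //=.
  by rewrite ![v == _]eq_sym (valP x) (valP y).
apply: (piece_insert (@adj_sym H) kab _ pC).
- by move=> w vw; have : w \in neighbors v by [rewrite inE]; rewrite E !inE.
- by rewrite inC eqxx.
- by rewrite eq_sym; apply: (valP x).
- by rewrite eq_sym; apply: (valP y).
- by rewrite inC adj_neq //; case: (a == val x); case: (a == val y).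
- by rewrite inC adj_neq //; case: (b == val x); case: (b == val y).
Qed.

(** * From subgraphs of a 2-tree to the 2-tree *)

Lemma longest_pathP (G : sgraph) (p : seq G) : longest_path p ->
  (forall q : seq G, longest_path q <-> longest (@adj G) (path_length p) q) /\
  (forall x A, path (@adj G) x A -> uniq (x :: A) -> size A <= path_length p).
Proof.
move=> [pp pmax]; split=> [q|x A pA uA]; last first.
  by apply: (pmax (x :: A)); rewrite /is_path uA /=.
split=> [[qp qmax]|[uq sq szq]].
  have [/and3P[q0 uq sq] /and3P[p0 _ _]] := (qp, pp); split=> //.
  have := pmax q qp; have := qmax p pp; rewrite /path_length.
  by case: (q) q0 => //= ? ?; lia.
have qp : is_path q by apply/and3P; split=> //; case: (q) szq.
by split=> // r /pmax rp; rewrite [leqRHS]/path_length szq.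
Qed.

Section Transport.

Variables (G : sgraph) (T : finType) (h : G -> T).
Hypothesis h_inj : injective h.

(** The copy of [G] on the vertices of a larger graph; vertices outside the
    image are isolated. *)
Definition image_adj : rel T :=
  fun u v => [exists a, exists b, [&& adj a b, h a == u & h b == v]].

Lemma image_adjP u v : reflect (exists a b, [/\ adj a b, h a = u & h b = v]) (image_adj u v).
Proof.
apply: (iffP existsP) => [[a /existsP[b /and3P[ab /eqP <- /eqP <-]]]|[a [b [ab <- <-]]]].
  by exists a, b.
by exists a; apply/existsP; exists b; rewrite ab !eqxx.
Qed.

Lemma image_adjE a b : image_adj (h a) (h b) = adj a b.
Proof.
apply/image_adjP/idP => [[a' [b' [ab /h_inj <- /h_inj <-]]]//|ab].
by exists a, b.
Qed.

Lemma image_adj_sym : symmetric image_adj.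
Proof.
move=> u v; apply/image_adjP/image_adjP => -[a [b [ab ha hb]]];
by exists b, a; rewrite adj_sym.
Qed.

Lemma image_path x A : A != [::] -> path image_adj x A ->
  exists a B, [/\ x = h a, A = map h B & path (@adj G) a B].
Proof.
elim: A x => // y A IH x _ /= /andP[/image_adjP[a [b [ab <- <-]]] pA].
have [A0|A0] := eqVneq A [::]; first by exists a, [:: b]; rewrite A0 /= ab.
have [b' [B [/h_inj <- -> pB]]] := IH _ A0 pA.
by exists a, (b :: B); rewrite /= ab.
Qed.

Lemma longest_map L p : longest (@adj G) L p -> longest image_adj L (map h p).
Proof.
case=> up sp szp; split; rewrite ?map_inj_uniq ?size_map //.
case: p sp {up szp} => //= x p; rewrite path_map.
by rewrite (eq_path (e' := @adj G)) // => a b; apply: image_adjE.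
Qed.

Lemma longest_image L p : 0 < L -> longest image_adj L p ->
  exists2 q, p = map h q & longest (@adj G) L q.
Proof.
case: p => [|x A] L0 [] // up /= sp [szA].
have [|a [B [xE AE pB]]] := image_path _ sp; first by case: (A) szA L0 => // <-.
exists (a :: B); first by rewrite xE AE.
have pE : x :: A = map h (a :: B) by rewrite xE AE.
split=> //; first by rewrite -(map_inj_uniq h_inj) -pE.
by rewrite /= -szA AE size_map.
Qed.

End Transport.

Theorem theorem13 (G : sgraph) :
  connected_graph G -> series_parallel G ->
  exists v : G, forall p : seq G, longest_path p -> v \in p.
Proof.
move=> [/card_gt0P[v0 _] conn] [H [tH [h [h_inj hK]]]].
apply: NNPP => no.
have avoid v : exists2 p : seq G, longest_path p & v \notin p.
  apply: NNPP => nov; case: no; exists v => p lp.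
  by apply/negPn/negP => vp; case: nov; exists p.
have [p0 lp0 v0p] := avoid v0.
have [lpE bnd] := longest_pathP lp0; set L := path_length p0 in lpE bnd.
(* isolated vertices of the copy are not longest paths *)
have L0 : 0 < L.
  have [/and3P[+ _ _] p0max] := lp0; case: (p0) v0p => // w p' v0w _.
  have wv0 : w != v0 by apply: contraNneq v0w => ->; apply: mem_head.
  have /connectP[[|u c] /= pc lc] := conn w v0; first by rewrite lc eqxx in wv0.
  have /andP[wu _] := pc; apply: (p0max [:: w; u]).
  rewrite /is_path /= wu !andbT inE.
  by apply: contraTneq wu => ->; rewrite adj_irrefl.
have [x [y pxy]] := two_tree_piece tH.
apply: (@piece_no_counterexample _ (image_adj h) L _ _ _ _ _ pxy); last first.
  by move=> _ _ /image_adjP[a [b [ab <- <-]]]; apply: hK.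
split.
- exact: image_adj_sym.
- move=> u A pA uA; case: (eqVneq A [::]) => [->//|A0].
  have [a [B [xE AE pB]]] := image_path h_inj A0 pA.
  rewrite AE size_map; apply: (bnd a B pB).
  by move: uA; rewrite xE AE -map_cons map_inj_uniq.
- move=> p q lp lq; have [p' pE lp'] := longest_image h_inj L0 lp.
  have [q' qE lq'] := longest_image h_inj L0 lq.
  have [v vp vq] := connected_longest_meet (@adj_sym G) bnd conn lp' lq'.
  by exists (h v); rewrite ?pE ?qE map_f.
- move=> v; have [[a va]|nov] := classic (exists a, v = h a).
    have [p lp ap] := avoid a; exists (map h p).
      by apply: longest_map => //; apply/lpE.
    by rewrite va mem_map.
  exists (map h p0); first by apply: longest_map => //; apply/lpE.
  by apply/mapP => -[a _ va]; case: nov; exists a.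
Qed.
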